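(* Let $\alpha\in(0,1)$ and $T>0$. Then the solution of the groundwater flow problem $$ {}^{CF}\mathcal{D}_t^{\alpha}h(r,t)=\vartheta(r)\,\partial_r h(r,t)+\gamma\,\mathcal{L}^{\alpha}h(r,t),\qquad t\in(0,T),\qquad h(r,0)=h_0(r), $$ is unique; that is, if $h$ and $\varphi$ are two solutions of this problem with the same initial datum, $h(r,0)=\varphi(r,0)=h_0(r)$, then $h(r,t)=\varphi(r,t)$ for all $t\in(0,T)$ and all $r$.
   Context: Setting: $\Omega$ is the open bounded domain of a confined aquifer with radial variable $r>0$; the unknown $h=h(r,t)$ (the hydraulic head) is a function of $r$ and of time $t\in(0,T)$, with $h(\cdot,t)\in H^1_0(\Omega)$, regular enough for the operators below to make sense. $T_r>0$ (transmissivity) and $S>0$ (storativity) are constants, $\vartheta(r)=\frac{T_r}{rS}$ and $\gamma=\frac{T_r}{S}$. Caputo–Fabrizio time derivative of order $\alpha\in(0,1)$: $$ {}^{CF}\mathcal{D}_t^{\alpha}h(r,t)=\frac{B(\alpha)}{1-\alpha}\int_0^t \partial_s h(r,s)\exp\Big[-\frac{\alpha}{1-\alpha}(t-s)\Big]\,ds,\quad t>0,\qquad B(\alpha)=1-\alpha+\frac{\alpha}{\Gamma(\alpha)}. $$ Fractional Laplacian in the Caputo–Fabrizio sense of order $\alpha\in(0,1)$, with $\lambda=-\frac{\alpha}{1-\alpha}$: $$ \mathcal{L}^{\alpha}h(r,t)=\frac{\alpha}{(1-\alpha)\sqrt{\pi}}\int_0^r \exp\big[-\lambda^2(r-\tau)^2\big]\,\partial_{\tau\tau}h(\tau,t)\,d\tau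 . $$ *)

(* Defs.v *)
From HB Require Import structures.
From mathcomp Require Import all_boot all_order all_algebra.
From mathcomp Require Import all_classical all_reals all_analysis.

Set Implicit Arguments.
Unset Strict Implicit.
Unset Printing Implicit Defensive.

Import Order.TTheory GRing.Theory Num.Theory.
Import numFieldNormedType.Exports.

Local Open Scope classical_set_scope.
Local Open Scope ring_scope.

(* In ring_scope these notations denote derivatives of polynomials. *)
Local Notation "f ^` ()" := (derive1 f) : ring_scope.
Local Notation "f ^` ( n )" := (derive1n n f) : ring_scope.

Section Sobolev.
Context {R : realType}.
Implicit Types (Omega : set R) (f g phi : R -> R).

Local Notation mu := (@lebesgue_measure R).

Definition test_function Omega phi : Prop :=
  (forall n x, derivable (phi^`(n)) x 1) /\
  exists K : set R,
    [/\ compact K, K `<=` Omega & forall x, ~ K x -> phi x = 0].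

Definition L2 Omega f : Prop := f \_ Omega \in Lfun mu 2%:E.

Definition weak_derivative Omega f g : Prop :=
  forall phi, test_function Omega phi ->
    \int[mu]_(x in Omega) (f x * phi^`() x) =
    - \int[mu]_(x in Omega) (g x * phi x).

(* Square of the H^1(Omega)-norm of a function f with weak derivative g. *)
Definition H1_norm_sq Omega f g : \bar R :=
  ('N[mu]_2%:E[EFin \o (f \_ Omega)] ^+ 2 +
   'N[mu]_2%:E[EFin \o (g \_ Omega)] ^+ 2)%E.

(* The closure of the test functions in H^1(Omega). *)
Definition H10 Omega f : Prop :=
  exists g : R -> R,
    [/\ L2 Omega f, L2 Omega g, weak_derivative Omega f g &
        forall eps : R, 0 < eps ->
          exists2 phi, test_function Omega phi &
            (H1_norm_sq Omega (f \- phi)%R (g \- phi^`())%R < (eps ^+ 2)%:E)%E].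

End Sobolev.

(* h : R -> R -> R is written h r t, so that the partial derivatives in t and
   in r are (h r)^`() t and (h^~ t)^`() r respectively. *)
Section Operators.
Context {R : realType}.
Implicit Types (h : R -> R -> R) (alpha Tr S r t : R).

Local Notation mu := (@lebesgue_measure R).

Definition Gamma (x : R) : R :=
  \int[mu]_(s in `]0, +oo[) (s `^ (x - 1) * expR (- s)).

Definition CF_norm alpha : R := 1 - alpha + alpha / Gamma alpha.

Definition CF_deriv alpha h r t : R :=
  CF_norm alpha / (1 - alpha) *
  \int[mu]_(s in `]0, t[)
     ((h r)^`() s * expR (- (alpha / (1 - alpha)) * (t - s))).

Definition CF_lambda alpha : R := - (alpha / (1 - alpha)).

Definition CF_laplacian alpha h r t : R :=
  alpha / ((1 - alpha) * Num.sqrt pi) *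
  \int[mu]_(tau in `]0, r[)
     (expR (- (CF_lambda alpha ^+ 2 * (r - tau) ^+ 2)) * (h^~ t)^`(2) tau).

Definition theta Tr S r : R := Tr / (r * S).

Definition gamma Tr S : R := Tr / S.

(* A domain of the radial variable: nonempty, open, connected, bounded, r > 0. *)
Definition radial_domain (Omega : set R) : Prop :=
  [/\ Omega !=set0, open Omega, connected Omega, bounded_set Omega &
      Omega `<=` `]0, +oo[].

(* Time derivatives are taken on `]0, T[, space derivatives on Omega. The
   elements of H^1_0(Omega) are identified with their extensions by zero, so
   that the integral over `]0, r[ in CF_laplacian only sees `]0, r[ `&` Omega.
   No joint regularity in (r, t) is required. *)
Record regular (Omega : set R) (T : R) h : Prop := Regular {
  regular_H10 : forall t, 0 < t < T -> H10 Omega (h^~ t) ;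
  regular_zero_ext : forall t r, 0 < t < T -> ~ Omega r -> h r t = 0 ;
  (* continuity up to t = 0 is what gives a meaning to the initial condition *)
  regular_cont_t : forall r, Omega r -> {within `[0, T[, continuous (h r)} ;
  regular_diff_t : forall r t, Omega r -> 0 < t < T -> derivable (h r) t 1 ;
  regular_C1_t : forall r, Omega r -> {within `]0, T[, continuous (h r)^`()} ;
  regular_int_t : forall r t, Omega r -> 0 < t < T ->
    mu.-integrable `]0, t[ (EFin \o (h r)^`()) ;
  regular_diff_r : forall r t, Omega r -> 0 < t < T ->
    derivable (h^~ t) r 1 /\ derivable (h^~ t)^`() r 1 ;
  regular_C2_r : forall t, 0 < t < T ->
    {within Omega, continuous (h^~ t)^`(2)} ;
  regular_int_r : forall r t, Omega r -> 0 < t < T ->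
    mu.-integrable `]0, r[ (EFin \o (h^~ t)^`(2))
}.

Record groundwater_solution (Omega : set R) (T alpha Tr S : R) (h0 : R -> R) h
    : Prop := GroundwaterSolution {
  solution_regular : regular Omega T h ;
  solution_eq : forall r t, Omega r -> 0 < t < T ->
    CF_deriv alpha h r t =
    theta Tr S r * (h^~ t)^`() r + gamma Tr S * CF_laplacian alpha h r t ;
  solution_init : forall r, Omega r -> h r 0 = h0 r
}.

End Operators.

(* Main.v *)
Require Import Defs.
From mathcomp Require Import all_boot all_order all_algebra.
From mathcomp Require Import all_classical all_reals all_analysis.
From mathcomp Require Import measurable_realfun ring lra.
Import Order.TTheory GRing.Theory Num.Theory.
Import numFieldNormedType.Exports.
Local Open Scope classical_set_scope.
Local Open Scope ring_scope.

Set Implicit Arguments.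
Unset Strict Implicit.
Unset Printing Implicit Defensive.

(* Let w be the difference of two solutions, a the left end point of Omega,
   k = alpha / (1 - alpha) and b = CF_norm alpha / (1 - alpha) > 0. With
     F(r, t) = k int_0^t exp(k s) w(r, s) ds
   the Caputo-Fabrizio derivative of w is b (w - exp(- k t) F), so that the
   problem reads b (w - f) = theta w_r + gamma L w with f = exp(- k t) F. For each
   fixed t this is an equation in r alone. The operator L is of first order: an
   integration by parts turns it into w_r plus a memory of w_r, so, since w
   vanishes at a by the H^1_0 condition, a Gronwall argument starting from a
   bounds |w(r, t)| by C sup_r r |f(r, t)| with C independent of t. Hence F_t is
   controlled by the norm n(t) = sup_r r |F(r, t)|, and F(., 0) = 0.

   Without joint regularity, n is only finite at each t and lower semicontinuous.
   But on short intervals on which n is bounded it varies by at most a factor 2,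
   forwards and backwards in time, and together with a Baire category argument
   this makes n locally bounded; then n = 0, and w = 0 by the estimate above. *)

(** * Local boundedness of norms that double on short time intervals *)

Definition bounded_between {R : realType} (bnd : R -> R -> Prop) (u v : R) :=
  exists B, forall t, u <= t <= v -> bnd t B.

(* [bnd t B] stands for "the state at time t has norm at most B". *)
Record doubling {R : realType} (bnd : R -> R -> Prop) (s s' : R) : Prop := {
  doubling_mono : forall t B B', B <= B' -> bnd t B -> bnd t B' ;
  doubling_finite : forall t, s <= t <= s' -> exists B, bnd t B ;
  doubling_lsc : forall t N, s <= t <= s' -> ~ bnd t N ->
    exists2 d, 0 < d & forall u, s <= u <= s' -> `|u - t| < d -> ~ bnd u N ;
  doubling_le : forall u v B, s <= u -> v <= s' ->
    (forall t, u <= t <= v -> bnd t B) ->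
    forall t0 B0, u <= t0 <= v -> bnd t0 B0 ->
    forall t, u <= t <= v -> bnd t (2 * B0) }.

Lemma doubling_sub {R : realType} (bnd : R -> R -> Prop) (s s' u v : R) :
  doubling bnd s s' -> s <= u -> v <= s' -> doubling bnd u v.
Proof.
move=> [mono fin lsc le2] su vs; split => //.
- by move=> t tuv; apply: fin; lra.
- move=> t N tuv nb; have [|d d0 dP] := lsc t N _ nb; first lra.
  by exists d => // x xuv; apply: dP; lra.
- by move=> x y B ux yv; apply: le2; lra.
Qed.

(** All four conditions are invariant under time reversal, so the leftward argument of
    [bounded_between_left] also serves to the right. *)
Lemma doublingN {R : realType} (bnd : R -> R -> Prop) (s s' : R) :
  doubling bnd s s' -> doubling (fun t => bnd (- t)) (- s') (- s).
Proof.
move=> [mono fin lsc le2]; split.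
- by move=> t; exact: mono.
- by move=> t tss; apply: fin; lra.
- move=> t N tuv nb; have [|d d0 dP] := lsc (- t) N _ nb; first lra.
  exists d => // x xuv xt; apply: dP; first lra.
  by rewrite -opprD normrN.
- move=> x y B ux yv bxy t0 B0 t0xy b0 t txy.
  apply: (le2 (- y) (- x) B _ _ _ (- t0)) => //; try lra.
  by move=> z zyx; rewrite -(opprK z); apply: bxy; lra.
Qed.

Lemma bounded_between_cat {R : realType} (bnd : R -> R -> Prop) (s s' u v w : R) :
  doubling bnd s s' -> bounded_between bnd u v -> bounded_between bnd v w ->
  bounded_between bnd u w.
Proof.
move=> dbl [B1 b1] [B2 b2]; exists (Num.max B1 B2) => t tuw.
have [tv|tv] := lerP t v.
  by apply: (doubling_mono dbl _ (b1 t _)); [rewrite le_max lexx|lra].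
by apply: (doubling_mono dbl _ (b2 t _)); [rewrite le_max lexx orbT|lra].
Qed.

(* The infimum p of the u such that [u, t] is good is itself good; if p > s then
   p satisfies [bnd p N], hence t satisfies [bnd t (2 * N)]. *)
Lemma bounded_between_left {R : realType} (bnd : R -> R -> Prop) (s s' N t : R) :
  0 <= N -> doubling bnd s s' ->
  (forall u v, s <= u -> v <= s' -> (forall x, u <= x <= v -> ~ bnd x N) ->
    bounded_between bnd u v) ->
  s <= t <= s' -> ~ bnd t (2 * N) -> bounded_between bnd s t.
Proof.
move=> N0 dbl good tss nbt.
pose A := [set u | s <= u <= t /\ bounded_between bnd u t].
have [Bt bt] := doubling_finite dbl tss.
have At : A t.
  split; first lra.
  by exists Bt => x xt; have -> : x = t by lra.
have infA : has_inf A.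
  by split; [exists t | exists s => u [] /andP[]].
set p := inf A.
have sp : s <= p by apply: lb_le_inf; [exists t | move=> u [] /andP[]].
have pt : p <= t by apply: ge_inf => //; case: infA.
have Aright u : p < u <= t -> A u.
  move=> /andP[pu ut]; have [x [/andP[sx xt] [B bB]] xu] := inf_adherent (eps := u - p) ltac:(lra) infA.
  split; first lra.
  exists B => y yut; apply: bB; rewrite -/p in xu; lra.
(* The bounds on [u, t] might blow up as u tends to p; doubling from t replaces all of them by the
   single bound [2 * Bt]. *)
have ptB u : p < u <= t -> bnd u (2 * Bt).
  move=> put; have [sut [B bB]] := Aright _ put.
  apply: (doubling_le dbl (u := u) (v := t) (B := B) _ _ bB (t0 := t)) => //; lra.
have [Bp bp] := doubling_finite dbl (t := p) ltac:(lra).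
have Ap : A p.
  split; first lra.
  exists (Num.max Bp (2 * Bt)) => x xpt.
  have [->|xp] := eqVneq x p; first by apply: (doubling_mono dbl) bp; rewrite le_max lexx.
  apply: (doubling_mono dbl _ (ptB x _)); first by rewrite le_max lexx orbT.
  by move: xp xpt; rewrite lt_neqAle eq_sym => -> /andP[-> ->].
have [_ [B bB]] := Ap.
have nbp : ~ bnd p N.
  move=> bpN; apply: nbt.
  by apply: (doubling_le dbl (u := p) (v := t) (B := B) _ _ bB (t0 := p)) => //; lra.
(* By lower semicontinuity N still fails on [p', p], so this interval is good and p' lies in A.
   Minimality of p then forces p = s. *)
have [d d0 dP] := doubling_lsc dbl (t := p) ltac:(lra) nbp.
set p' := Num.max s (p - d / 2).
have sp' : s <= p' by rewrite le_max lexx.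
have p'd : p - d / 2 <= p' by rewrite le_max lexx orbT.
have p'p : p' <= p by rewrite ge_max; apply/andP; split => //; lra.
have gp' : bounded_between bnd p' p.
  apply: good => //; first lra.
  move=> x xp; apply: dP; first lra.
  by rewrite ler0_norm; lra.
have Ap' : A p'.
  split; first lra.
  by apply: (bounded_between_cat dbl gp'); exact: (proj2 Ap).
have : p <= p' by apply: ge_inf => //; case: infA.
rewrite /p' le_max => /orP[ps|pd]; last by exfalso; lra.
have -> : s = p by lra.
exact: (proj2 Ap).
Qed.

(** Otherwise every interval on which N fails throughout is good. Either 2 * N holds everywhere, or
    it fails at some t, and then [bounded_between_left], used forwards and in reversed time, bounds
    the state on both sides of t. *)
Lemma bad_subinterval {R : realType} (bnd : R -> R -> Prop) (s s' N : R) :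
  0 <= N -> doubling bnd s s' -> ~ bounded_between bnd s s' ->
  exists u v, [/\ s <= u, v <= s', ~ bounded_between bnd u v &
    forall t, u <= t <= v -> ~ bnd t N].
Proof.
move=> N0 dbl bad; apply: contrapT => nex; apply: bad.
have good u v : s <= u -> v <= s' -> (forall x, u <= x <= v -> ~ bnd x N) ->
    bounded_between bnd u v.
  by move=> su vs nb; apply: contrapT => bad; apply: nex; exists u, v.
have [all2|] := pselect (forall t, s <= t <= s' -> bnd t (2 * N)).
  by exists (2 * N).
move=> /existsNP[t] /not_implyP[tss nbt].
have gl : bounded_between bnd s t by exact: (bounded_between_left N0 dbl good).
have [B bB] : bounded_between (fun x => bnd (- x)) (- s') (- t).
  apply: (bounded_between_left N0 (doublingN dbl)); first 2 last.
  - by rewrite opprK.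
  - move=> u v su vs nb; have [|||B bB] := good (- v) (- u); try lra.
      by move=> x xuv; rewrite -(opprK x); apply: nb; lra.
    by exists B => x xuv; apply: bB; lra.
  - by lra.
apply: (bounded_between_cat dbl gl).
by exists B => x xts; rewrite -(opprK x); apply: bB; lra.
Qed.

(* A Baire category argument: otherwise nested intervals on which the bounds 0,
   1, 2, ... all fail would have a common point. *)
Lemma doubling_bounded {R : realType} (bnd : R -> R -> Prop) (s s' : R) :
  doubling bnd s s' -> bounded_between bnd s s'.
Proof.
move=> dbl; apply: contrapT => bad.
pose P (p : R * R) := [/\ s <= p.1, p.2 <= s' & ~ bounded_between bnd p.1 p.2].
have step (np : nat * R * R) : exists q : R * R, P (np.1.2, np.2) ->
    [/\ P q, np.1.2 <= q.1, q.2 <= np.2 & forall t, q.1 <= t <= q.2 -> ~ bnd t np.1.1%:R].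
  (* Choice needs a value at every triple; (0, 0) is a dummy where P fails. *)
  have [[/= p1 p2 pbad]|nP] := pselect (P (np.1.2, np.2)); last by exists (0, 0).
  have [u [v [pu vp bad' nb]]] := bad_subinterval (ler0n _ np.1.1)
    (doubling_sub dbl p1 p2) pbad.
  by exists (u, v) => _; split => //=; split => //=; lra.
have [f fP] := choice step.
pose I := fix I n := if n is m.+1 then f (m, (I m).1, (I m).2) else (s, s').
have PI n : P (I n).
  elim: n => [|n IH]; first by split => //=.
  have := fP (n, (I n).1, (I n).2); rewrite /= -surjective_pairing.
  by move=> /(_ IH)[].
have stepI n : [/\ (I n).1 <= (I n.+1).1, (I n.+1).2 <= (I n).2 &
    forall t, (I n.+1).1 <= t <= (I n.+1).2 -> ~ bnd t n%:R].
  have := fP (n, (I n).1, (I n).2); rewrite /= -surjective_pairing.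
  by move=> /(_ (PI n))[].
(* A bad interval is nonempty, since an empty one is trivially bounded. *)
have leI n : (I n).1 <= (I n).2.
  rewrite leNgt; apply/negP => lt; have [_ _] := PI n; apply.
  by exists 0 => t tI; exfalso; lra.
have nested n m : (I n).1 <= (I (n + m)%N).1 /\ (I (n + m)%N).2 <= (I n).2.
  elim: m => [|m [IH1 IH2]]; first by rewrite addn0.
  by rewrite addnS; have [? ? _] := stepI (n + m)%N; split; lra.
have cross n m : (I n).1 <= (I m).2.
  have [h1 _] := nested n m; have [_ h2] := nested m n.
  by rewrite addnC in h2; have := leI (n + m)%N; lra.
pose A := range (fun n => (I n).1).
pose t := sup A.
have A0 : A (I 0%N).1 by exists 0%N.
have ubA : has_ubound A by exists (I 0%N).2 => _ [n _ <-]; exact: cross.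
have tI n : (I n).1 <= t <= (I n).2.
  apply/andP; split; first by apply: ub_le_sup => //; exists n.
  by apply: ge_sup; [exists (I 0%N).1 | move=> _ [m _ <-]; exact: cross].
have [B bB] := doubling_finite dbl (tI 0%N).
(* The interval [I n.+1] excludes the bound n; here n is [truncn B] + 1, which exceeds B. *)
have tI' := tI (Num.truncn B).+2.
have [_ _] := stepI (Num.truncn B).+1.
move=> /(_ t tI'); apply; apply: (doubling_mono dbl) bB.
exact/ltW/truncnS_gt.
Qed.

(** * Mean value inequalities *)

Lemma within_continuous_dist {R : realType} (A : set R) (f : R -> R) (x e : R) :
  {within A, continuous f} -> A x -> 0 < e ->
  exists2 d, 0 < d & forall y, A y -> `|y - x| < d -> `|f y - f x| < e.
Proof.
move=> /subspace_continuousP cf Ax e0.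
have /cvgrPdist_lt /(_ _ e0) := cf x Ax.
rewrite /within/= => -[d /= d0 dP]; exists d => // y Ay yx.
by rewrite distrC; apply: dP => //=; rewrite distrC.
Qed.

(** Both m + g and m - g have a nonnegative derivative, hence are nondecreasing; the sign s treats
    the two at once. *)
Lemma increment_le {R : realType} (g dg m dm : R -> R) (x0 x1 : R) :
  x0 <= x1 ->
  {within `[x0, x1], continuous g} -> {within `[x0, x1], continuous m} ->
  (forall x, x0 < x < x1 -> is_derive x 1 g (dg x)) ->
  (forall x, x0 < x < x1 -> is_derive x 1 m (dm x)) ->
  (forall x, x0 < x < x1 -> `|dg x| <= dm x) ->
  `|g x1 - g x0| <= m x1 - m x0.
Proof.
move=> x01 cg cm dgP dmP le.
have mono (s : R) : `|s| = 1 -> m x0 + s * g x0 <= m x1 + s * g x1.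
  move=> s1; pose F x := m x + s * g x.
  have dF x : x0 < x < x1 -> is_derive x 1 F (dm x + s * dg x).
    by move=> xx; have := dgP x xx; have := dmP x xx => ? ?; exact: is_deriveD.
  have F1 x : x \in `]x0, x1[ -> derivable F x 1.
    by rewrite in_itv/= => /dF[].
  have F2 x : x \in `]x0, x1[ -> 0 <= derive1 F x.
    rewrite in_itv/= => xx; have d := dF x xx.
    rewrite derive1E derive_val.
    rewrite -lerBlDr sub0r; apply: le_trans (le _ xx).
    by rewrite (le_trans (ler_norm _))// normrN normrM s1 mul1r.
  have F3 : {within `[x0, x1], continuous F}.
    suff : {within `[x0, x1], continuous (m + s *: g)} by [].
    by move=> x; apply: continuousD; [exact: cm | apply: continuousZl_tmp; exact: cg].
  have F4 := ger0_derive1_le_cc F1 F2 F3.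
  have x0in : x0 \in `[x0, x1] by rewrite in_itv/= lexx x01.
  have x1in : x1 \in `[x0, x1] by rewrite in_itv/= lexx x01.
  exact: F4 _ _ x0in x1in x01.
have := mono 1 (normr1 _); have := mono (-1); rewrite normrN normr1 => /(_ erefl).
by rewrite ler_norml => h1 h2; apply/andP; split; lra.
Qed.

Lemma increment_le_linear {R : realType} (g dg : R -> R) (x0 x1 K : R) :
  x0 <= x1 ->
  {within `[x0, x1], continuous g} ->
  (forall x, x0 < x < x1 -> is_derive x 1 g (dg x)) ->
  (forall x, x0 < x < x1 -> `|dg x| <= K) ->
  `|g x1 - g x0| <= K * (x1 - x0).
Proof.
move=> x01 cg dgP le; rewrite mulrBr.
have dm (x : R) : is_derive x 1 (fun y => K * y) K.
  by apply: is_derive_eq; rewrite /GRing.scale/=; lra.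
apply: (increment_le x01 cg _ dgP (m := fun x => K * x) (dm := fun=> K)) => //.
by apply: continuous_subspaceT => x; exact: mulrl_continuous.
Qed.

(** The factor 1 / lam gained by integrating the exponential is what lets a large lam absorb the
    memory terms in the spatial estimate. *)
Lemma increment_le_expR {R : realType} (g dg : R -> R) (x0 x1 K lam : R) :
  0 <= K -> 0 < lam -> x0 <= x1 ->
  {within `[x0, x1], continuous g} ->
  (forall x, x0 < x < x1 -> is_derive x 1 g (dg x)) ->
  (forall x, x0 < x < x1 -> `|dg x| <= K * expR (lam * (x - x0))) ->
  `|g x1 - g x0| <= K / lam * expR (lam * (x1 - x0)).
Proof.
move=> K0 lam0 x01 cg dgP le.
have dm (x : R) : is_derive x 1 (fun y => K / lam * expR (lam * (y - x0)))
    (K * expR (lam * (x - x0))).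
  apply: is_derive_eq; rewrite /GRing.scale/=; field; lra.
apply: le_trans (increment_le x01 cg _ dgP (fun x _ => dm x) le) _.
  apply: derivable_within_continuous => x _.
  by have [] := dm x.
by rewrite gerBl mulr_ge0 ?expR_ge0// divr_ge0// ltW.
Qed.

(** * Evolution of a family of functions of time with a pointwise finite norm *)

(* On an interval of length at most 1 / (2 C), a bound B on the whole family
   improves to B0 + B / 2, where B0 is a bound at one time t0. *)
Lemma evolution_doubling {R : realType} {X : Type} (G dG : X -> R -> R)
    (T C s s' : R) :
  0 < C ->
  (forall x, {within `[0, T[, continuous (G x)}) ->
  (forall x t, 0 < t < T -> is_derive t 1 (G x) (dG x t)) ->
  (forall t B, 0 < t < T -> (forall x, `|G x t| <= B) ->
    forall x, `|dG x t| <= C * B) ->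
  (forall t, 0 <= t < T -> exists B, forall x, `|G x t| <= B) ->
  0 <= s -> s' < T -> C * (s' - s) <= 2^-1 ->
  doubling (fun t B => forall x, `|G x t| <= B) s s'.
Proof.
move=> C0 cG dGP dGle Gfin s0 sT Cs; split.
- by move=> t B B' BB' b x; apply: le_trans BB'.
- by move=> t tss; apply: Gfin; lra.
(* Failure of a bound is witnessed by a single member of the family, whose continuity in time makes
   it persist nearby. *)
- move=> t N tss /existsNP[x] /negP; rewrite -ltNge => xN.
  have t0T : [set` `[0, T[] t by rewrite /= in_itv/=; lra.
  have [|d d0 dP] := within_continuous_dist (e := `|G x t| - N) (cG x) t0T.
    by rewrite subr_gt0.
  exists d => // u uss ut /(_ x) uN.
  have := dP u _ ut; rewrite /= in_itv/= => /(_ ltac:(lra)).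
  have := ler_dist_dist (G x t) (G x u); rewrite distrC => h1 h2.
  have : `|G x t| - `|G x u| <= `|G x t - G x u|.
    by rewrite (le_trans (ler_norm _))// ler_dist_dist.
  rewrite distrC; lra.
- move=> u v B su vs bB t0 B0 t0uv b0.
  (* The derivative is at most C * M and the length at most 1 / (2 C), whence the increment M /
     2. *)
  have lip (x : X) (y z : R) M : u <= y -> y <= z -> z <= v ->
      (forall t, u <= t <= v -> forall x, `|G x t| <= M) ->
      `|G x z - G x y| <= M / 2.
    move=> uy yz zv bM.
    have M0 : 0 <= M by apply: le_trans (bM y _ x) => //; lra.
    apply: (@le_trans _ _ (C * M * (z - y))).
      apply: (increment_le_linear (dg := dG x)) => //.
      - apply: continuous_subspaceW (cG x) => t /=; rewrite !in_itv/=; lra.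
      - by move=> t tyz; apply: dGP; lra.
      - by move=> t tyz; apply: dGle; [lra | move=> x'; apply: bM; lra].
    have : C * (z - y) <= 2^-1 by apply: le_trans Cs; rewrite ler_pM2l//; lra.
    by move=> h; rewrite mulrAC mulrC ler_wpM2l.
  have improve M : (forall t, u <= t <= v -> forall x, `|G x t| <= M) ->
      forall t, u <= t <= v -> forall x, `|G x t| <= B0 + M / 2.
    move=> bM t tuv x; have := b0 x.
    have : `|G x t| - `|G x t0| <= `|G x t - G x t0|.
      by rewrite (le_trans (ler_norm _))// ler_dist_dist.
    have [tt0|tt0] := lerP t t0.
      by have := lip x t t0 M ltac:(lra) tt0 ltac:(lra) bM; rewrite distrC; lra.
    by have := lip x t0 t M ltac:(lra) (ltW tt0) ltac:(lra) bM; lra.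
  (* The map M -> B0 + M / 2 has the fixed point 2 * B0, which its iterates approach
     geometrically. *)
  have iter_improve n t : u <= t <= v -> forall x, `|G x t| <= 2 * B0 + B / 2 ^+ n.
    elim: n t => [|n IH] t tuv x.
      have B00 : 0 <= B0 by apply: le_trans (b0 x).
      by rewrite expr0 divr1; have := bB t tuv x; lra.
    have := improve _ IH t tuv x; rewrite exprS invfM; lra.
  move=> t tuv x; apply/ler_addgt0Pl => e e0.
  have [n Bn] : exists n, B / 2 ^+ n <= e.
    have [B0'|B0'] := lerP B 0.
      by exists 0%N; rewrite expr0 divr1; lra.
    exists (Num.truncn (B / e)).+1.
    rewrite ler_pdivrMr ?exprn_gt0// mulrC -ler_pdivrMr//.
    apply: le_trans (ltW (truncnS_gt _)) _.
    by rewrite -natrX ler_nat ltnW// ltn_expl.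
  by have := iter_improve n t tuv x; lra.
Qed.

(** Time is cut into steps of length D = 1 / (2 C). On each step [doubling_bounded] supplies a
    bound, so the doubling inequality applies from the left end, where the norm is 0, and 2 * 0 = 0
    propagates. *)
Lemma evolution_eq0 {R : realType} {X : Type} (G dG : X -> R -> R) (T C : R) :
  0 < C ->
  (forall x, G x 0 = 0) ->
  (forall x, {within `[0, T[, continuous (G x)}) ->
  (forall x t, 0 < t < T -> is_derive t 1 (G x) (dG x t)) ->
  (forall t B, 0 < t < T -> (forall x, `|G x t| <= B) ->
    forall x, `|dG x t| <= C * B) ->
  (forall t, 0 < t < T -> exists B, forall x, `|G x t| <= B) ->
  forall x t, 0 <= t < T -> G x t = 0.
Proof.
move=> C0 G0 cG dGP dGle Gfin.
have Gfin' t : 0 <= t < T -> exists B, forall x, `|G x t| <= B.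
  have [->|t0] := eqVneq t 0; first by exists 0 => x; rewrite G0 normr0.
  by move=> tT; apply: Gfin; rewrite lt_neqAle eq_sym t0.
have step s s' : 0 <= s -> s <= s' -> s' < T -> C * (s' - s) <= 2^-1 ->
    (forall x, G x s = 0) -> forall x, G x s' = 0.
  move=> s0 ss' s'T Cs Gs x.
  have dbl := evolution_doubling C0 cG dGP dGle Gfin' s0 s'T Cs.
  have [B bB] := doubling_bounded dbl.
  have /(_ x) := doubling_le dbl (lexx s) (lexx s') bB (t0 := s) (B0 := 0) ltac:(lra)
    (fun x => ltac:(by rewrite Gs normr0)) (t := s') ltac:(lra).
  by rewrite mulr0 normr_le0 => /eqP.
pose D := (2 * C)^-1.
have D0 : 0 < D by rewrite invr_gt0; lra.
have CD : C * D = 2^-1 by rewrite /D; field; lra.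
have chain n : forall t, 0 <= t < T -> t <= n%:R * D -> forall x, G x t = 0.
  elim: n => [|n IH] t tT tn.
    by have -> : t = 0 by move: tn; rewrite mul0r; lra.
  have [tn'|tn'] := lerP t (n%:R * D); first exact: IH.
  have nD : 0 <= n%:R * D by rewrite mulr_ge0// ltW.
  apply: (step (n%:R * D)) => //; try lra.
  - by rewrite -CD ler_pM2l//; move: tn; rewrite -natr1 mulrDl; lra.
  - by apply: IH => //; lra.
move=> x t tT; apply: (chain (Num.truncn (t / D)).+1) => //.
by rewrite -ler_pdivrMr//; exact/ltW/truncnS_gt.
Qed.

(** * Primitives of integrable functions *)

Section Primitive.
Context {R : realType}.
Notation mu := (@lebesgue_measure R).
Implicit Types (f h : R -> R) (p a c x e B : R).

Lemma integrable_mulBl (D : set R) h f B : measurable D -> measurable_fun D h ->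
  (forall x, D x -> `|h x| <= B) -> mu.-integrable D (EFin \o f) ->
  mu.-integrable D (EFin \o (fun x => h x * f x)).
Proof.
move=> mD mh hB fi.
suff : mu.-integrable D ((EFin \o h) \* (EFin \o f))%E by [].
apply: integrableMr => //; exists B; split; first exact: num_real.
by move=> M BM x Dx /=; apply: le_trans (ltW BM); exact: hB.
Qed.

Lemma integrable_fun_add (D : set R) f h : measurable D ->
  mu.-integrable D (EFin \o f) -> mu.-integrable D (EFin \o h) ->
  mu.-integrable D (EFin \o (fun x => f x + h x)).
Proof.
move=> mD fi hi; suff : mu.-integrable D ((EFin \o f) \+ (EFin \o h))%E by [].
exact: integrableD.
Qed.

Lemma integrable_fun_sub (D : set R) f h : measurable D ->
  mu.-integrable D (EFin \o f) -> mu.-integrable D (EFin \o h) ->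
  mu.-integrable D (EFin \o (fun x => f x - h x)).
Proof.
move=> mD fi hi; suff : mu.-integrable D ((EFin \o f) \- (EFin \o h))%E by [].
exact: integrableB.
Qed.

Lemma integrable_itv_oo_sub p c x f : x <= c ->
  mu.-integrable `]p, c[ (EFin \o f) -> mu.-integrable `]p, x[ (EFin \o f).
Proof.
move=> xc; apply: integrableS => //=.
by apply: subset_itvl; rewrite bnd_simp.
Qed.

Lemma is_derive_primitive p c x f : p < x < c ->
  mu.-integrable `]p, c[ (EFin \o f) -> {for x, continuous f} ->
  is_derive x 1 (fun y => \int[mu]_(t in `]p, y[) f t) (f x).
Proof.
move=> /andP[px xc] fi cfx.
pose u := (x + c) / 2.
have xu : x < u by rewrite /u; lra.
have uc : u < c by rewrite /u; lra.
have fiu : mu.-integrable [set` Interval (BRight p) (BRight u)] (EFin \o f).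
  by apply: integrableS fi => //=; apply: subset_itvl; rewrite bnd_simp.
have px' : (BRight p < BRight x)%O by rewrite bnd_simp.
have [dF F'] := continuous_FTC1 xu fiu px' cfx.
(* Near x the open and the half-closed interval give the same primitive, and the fundamental theorem
   of calculus applies to the latter. *)
apply: (near_eq_is_derive (f := fun y => \int[mu]_(t in `]p, y]) f t)).
  near=> y; rewrite Rintegral_itv_bndo_bndc//; apply: integrable_itv_oo_sub fi.
  by apply: ltW; near: y; exact: lt_nbhsl.
by apply: DeriveDef; [exact: dF | rewrite -derive1E; exact: F'].
Unshelve. all: by end_near. Qed.

Lemma normr_primitive_le p c x f : x <= c ->
  mu.-integrable `]p, c[ (EFin \o f) ->
  `|\int[mu]_(t in `]p, x[) f t| <= \int[mu]_(t in `]p, c[) `|f t|.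
Proof.
move=> xc fi; have fix_ := integrable_itv_oo_sub xc fi.
apply: le_trans (le_normr_Rintegral _ fix_) _ => //.
have fin := integrable_norm fi.
have finx : mu.-integrable `]p, x[ (EFin \o (fun t => `|f t|)).
  exact: integrable_itv_oo_sub fin.
rewrite /Rintegral fine_le//.
- exact: integrable_fin_num.
- exact: integrable_fin_num.
apply: ge0_subset_integral => //=.
- exact: measurable_int fin.
- by apply: subset_itvl; rewrite bnd_simp.
Qed.

(** As f vanishes on ]p, a[, the integral only sees [a, x[, of measure less than d, and absolute
    continuity of the integral applies. *)
Lemma primitive_norm_small p a c e f : p <= a ->
  mu.-integrable `]p, c[ (EFin \o f) -> (forall x, p < x < a -> f x = 0) ->
  0 < e -> exists2 d, 0 < d &
    forall x, a < x < a + d -> x <= c -> \int[mu]_(t in `]p, x[) `|f t| <= e.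
Proof.
move=> pa fi f0 e0.
have gi : mu.-integrable setT (EFin \o (f \_ `]p, c[)).
  by rewrite -restrict_EFin; apply/integrable_restrict => //=; rewrite setTI.
have [d [d0 dP]] := integral_normr_continuous gi e0.
exists d => // x /andP[ax xd] xc.
rewrite [leLHS](_ : _ = \int[mu]_(t in `[a, x[) `|(f \_ `]p, c[) t|); last first.
  rewrite Rintegral_mkcond [RHS]Rintegral_mkcond; congr Rintegral.
  apply/funext => t; rewrite /patch/= !mem_setE !in_itv/=.
  have [tx|tx] := ltP t x; rewrite ?andbT ?andbF//.
  have [pt|pt] := ltP p t => /=; last by case: ifP => // _; rewrite normr0.
  rewrite (lt_le_trans tx xc)/=.
  by case: leP => // ta; rewrite f0 ?normr0// pt ta.
apply/ltW/dP => //=.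
rewrite lebesgue_measure_itv/= lte_fin ax -EFinD lte_fin; lra.
Qed.

End Primitive.

(** * A priori estimate for the equation in r at a fixed time *)

(* The condition on ]0, a[ reflects the identification of v with its extension
   by 0. *)
Record profile {R : realType} (a c : R) (v v1 v2 : R -> R) : Prop := {
  profile_d1 : forall x, a < x < c -> is_derive x 1 v (v1 x) ;
  profile_d2 : forall x, a < x < c -> is_derive x 1 v1 (v2 x) ;
  profile_cont : forall x, a < x < c -> {for x, continuous v2} ;
  profile_int : (@lebesgue_measure R).-integrable `]0, c[ (EFin \o v2) ;
  profile_ext : forall x, 0 < x < a -> v2 x = 0 ;
  profile_bdry : forall e, 0 < e ->
    exists2 d, 0 < d & forall x, a < x < a + d -> x < c -> `|v x| <= e }.

Section GaussianMemory.
Context {R : realType}.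
Notation mu := (@lebesgue_measure R).

Definition gauss_kernel (k r x : R) : R := expR (- (k ^+ 2 * (r - x) ^+ 2)).

(** With k = [CF_lambda alpha] and v2 the second space derivative of the head, this is
    [CF_laplacian] without its prefactor. *)
Definition gauss_memory (k : R) (v2 : R -> R) (r : R) : R :=
  \int[mu]_(x in `]0, r[) (gauss_kernel k r x * v2 x).

Lemma gauss_kernel_ge0 (k r x : R) : 0 <= gauss_kernel k r x.
Proof. exact: expR_ge0. Qed.

Lemma gauss_kernel_le1 (k r x : R) : gauss_kernel k r x <= 1.
Proof.
by rewrite -[leRHS]expR0 ler_expR oppr_le0 mulr_ge0 ?sqr_ge0.
Qed.

Lemma gauss_kernel_diag (k r : R) : gauss_kernel k r r = 1.
Proof. by rewrite /gauss_kernel subrr expr0n/= mulr0 oppr0 expR0. Qed.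

Lemma is_derive_gauss_kernel (k r x : R) :
  is_derive x 1 (gauss_kernel k r) (2 * k ^+ 2 * (r - x) * gauss_kernel k r x).
Proof.
rewrite /gauss_kernel; apply: is_derive_eq.
by rewrite /GRing.scale/=; ring.
Qed.

Lemma continuous_gauss_kernel (k r : R) : continuous (gauss_kernel k r).
Proof.
move=> x; apply: differentiable_continuous; apply/derivable1_diffP.
by have [] := is_derive_gauss_kernel k r x.
Qed.

Lemma integrable_gauss_kernel (k r c : R) (v2 : R -> R) :
  mu.-integrable `]0, c[ (EFin \o v2) ->
  mu.-integrable `]0, c[ (EFin \o (fun x => gauss_kernel k r x * v2 x)).
Proof.
apply: (@integrable_mulBl _ _ _ _ 1) => //.
  apply: measurable_funTS; apply: continuous_measurable_fun.
  exact: continuous_gauss_kernel.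
by move=> x _; rewrite ger0_norm ?gauss_kernel_ge0 ?gauss_kernel_le1.
Qed.

Lemma gauss_primitive_le (k r c x : R) (v2 : R -> R) : x < c ->
  mu.-integrable `]0, c[ (EFin \o v2) ->
  `|\int[mu]_(y in `]0, x[) (gauss_kernel k r y * v2 y)| <=
  \int[mu]_(y in `]0, x[) `|v2 y|.
Proof.
move=> xc vi.
have vix := integrable_itv_oo_sub (ltW xc) vi.
have gix := integrable_gauss_kernel k r vix.
apply: le_trans (le_normr_Rintegral _ gix) _ => //.
apply: le_Rintegral => //.
- exact: integrable_norm gix.
- exact: integrable_norm vix.
- move=> y _; rewrite normrM ger0_norm ?gauss_kernel_ge0//.
  by rewrite ler_piMl ?gauss_kernel_le1.
Qed.

(* Integration by parts turns the memory of v'' into v' plus a memory of v'. *)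
Lemma gauss_memory_near_derive (a c k lam M eta x0 r : R) (v v1 v2 : R -> R) :
  0 <= a -> profile a c v v1 v2 -> 0 < lam -> 0 <= M ->
  a < x0 -> x0 <= r -> r < c ->
  \int[mu]_(x in `]0, x0[) `|v2 x| <= eta ->
  (forall x, x0 <= x <= r -> `|v1 x| <= M * expR (lam * (x - x0))) ->
  `|gauss_memory k v2 r - v1 r| <=
    eta + `|v1 x0| + 2 * c * k ^+ 2 * M / lam * expR (lam * (r - x0)).
Proof.
move=> a0 pv lam0 M0 ax0 x0r rc eta_le v1M.
(* The terms with v2 cancel in the derivative of g, leaving the derivative of the kernel times v1.
   At r the kernel is 1, so g r is the quantity to be bounded. *)
pose Psi x := \int[mu]_(y in `]0, x[) (gauss_kernel k r y * v2 y).
pose g := Psi - (gauss_kernel k r * v1).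
have gi := integrable_gauss_kernel k r (profile_int pv).
have dg x : a < x < c ->
    is_derive x 1 g (- (2 * k ^+ 2 * (r - x) * gauss_kernel k r x * v1 x)).
  move=> xac; have d1 : is_derive x 1 Psi (gauss_kernel k r x * v2 x).
    apply: (is_derive_primitive (c := c)) => //; first lra.
    apply: continuousM; first exact: continuous_gauss_kernel.
    exact: (profile_cont pv).
  have d2 := is_derive_gauss_kernel k r x.
  have d3 := profile_d2 pv xac.
  apply: is_derive_eq; rewrite /GRing.scale/=; ring.
have : `|g r - g x0| <= 2 * c * k ^+ 2 * M / lam * expR (lam * (r - x0)).
  apply: increment_le_expR => //.
  - rewrite mulr_ge0// mulr_ge0 ?sqr_ge0//; lra.
  - apply: derivable_within_continuous => x; rewrite in_itv/= => xr.
    by have [] := dg x ltac:(lra).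
  - by move=> x xr; apply: dg; lra.
  move=> x xr /=; rewrite normrN.
  have vM := v1M x ltac:(lra).
  have ge0 : 0 <= (r - x) * gauss_kernel k r x.
    by rewrite mulr_ge0 ?gauss_kernel_ge0//; lra.
  have lec : (r - x) * gauss_kernel k r x <= c.
    apply: (@le_trans _ _ (r - x)); last lra.
    by rewrite ler_piMr ?gauss_kernel_le1//; lra.
  have k0 : 0 <= 2 * k ^+ 2 by rewrite mulr_ge0 ?sqr_ge0.
  rewrite [leLHS](_ : _ = 2 * k ^+ 2 * ((r - x) * gauss_kernel k r x * `|v1 x|)).
    rewrite [leRHS](_ : _ = 2 * k ^+ 2 * (c * (M * expR (lam * (x - x0))))); last ring.
    by rewrite ler_wpM2l// ler_pM.
  by rewrite -(mulrA (2 * k ^+ 2)) -mulrA normrM (ger0_norm k0) normrM (ger0_norm ge0).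
have -> : g r = gauss_memory k v2 r - gauss_kernel k r r * v1 r by [].
rewrite gauss_kernel_diag mul1r.
have -> : g x0 = Psi x0 - gauss_kernel k r x0 * v1 x0 by [].
have Psi0 : `|Psi x0| <= eta.
  by apply: le_trans eta_le; apply: gauss_primitive_le (profile_int pv); lra.
have kv : `|gauss_kernel k r x0 * v1 x0| <= `|v1 x0|.
  by rewrite normrM ger0_norm ?gauss_kernel_ge0// ler_piMl ?gauss_kernel_le1.
move: Psi0 kv; rewrite !ler_norml => /andP[? ?] /andP[? ?] /andP[? ?].
apply/andP; split; lra.
Qed.

End GaussianMemory.

Lemma normr_scaled_le {R : realType} (r c p x B : R) :
  0 <= r -> r <= c -> 0 <= p -> `|x| <= B -> `|r * p * x| <= c * p * B.
Proof.
move=> r0 rc p0 xB; rewrite normrM ger0_norm ?mulr_ge0//.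
by apply: ler_pM => //; rewrite ?mulr_ge0 ?ler_wpM2r.
Qed.

(* A bound M for the weighted derivative self-improves to P / ga + M / 2, so the
   optimal one is at most 2 P / ga. *)
Lemma profile_estimate_from {R : realType} (a c k b ga q x0 r0 eta n lam P : R)
    (v v1 v2 f : R -> R) :
  0 <= a -> 0 < b -> 0 < ga -> 0 <= q -> 0 <= eta ->
  profile a c v v1 v2 ->
  (forall r, a < r < c ->
    b * (v r - f r) = ga / r * v1 r + q * gauss_memory k v2 r) ->
  (forall r, a < r < c -> r * `|f r| <= n) ->
  a < x0 -> x0 <= r0 -> r0 < c -> `|v x0| <= eta ->
  \int[lebesgue_measure]_(x in `]0, x0[) `|v2 x| <= eta ->
  lam = 2 * (c * b + 2 * c ^+ 2 * q * k ^+ 2) / ga ->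
  P = c * b * eta + b * n + c * q * eta +
    c * q * ((c * b * eta + c * q * eta + b * n) / ga) ->
  `|v r0| <= eta + 2 * P / ga / lam * expR (lam * c).
Proof.
move=> a0 b0 ga0 q0 eta0 pv eqv fn ax0 x0r0 r0c vx0 vi lamE PE.
have c0 : 0 < c by lra.
have n0 : 0 <= n by apply: le_trans (fn x0 _); [rewrite mulr_ge0//; lra|lra].
(* D is the total coefficient with which the terms in M / lam enter below; lam = 2 * D / ga reduces
   their sum to half of the left-hand side. *)
pose D := c * b + 2 * c ^+ 2 * q * k ^+ 2.
have D0 : 0 < D.
  by rewrite ltr_pwDl ?mulr_gt0// mulr_ge0 ?sqr_ge0// mulr_ge0// mulr_ge0 ?sqr_ge0.
rewrite -/D in lamE.
have lam0 : 0 < lam by rewrite lamE divr_gt0// mulr_gt0.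
have eqr r : a < r < c ->
    ga * v1 r = r * b * v r - b * (r * f r) - r * q * gauss_memory k v2 r.
  move=> rac; have rn0 : r != 0 by rewrite gt_eqF//; lra.
  have -> : ga * v1 r = r * (ga / r * v1 r) by field.
  have -> : ga / r * v1 r = b * (v r - f r) - q * gauss_memory k v2 r.
    by rewrite eqv//; ring.
  ring.
have rf r : a < r < c -> `|b * (r * f r)| <= b * n.
  move=> rac; rewrite normrM gtr0_norm// ler_wpM2l ?(ltW b0)// normrM.
  by rewrite ger0_norm ?fn//; lra.
have x00 : 0 <= x0 by lra.
have x0c : x0 <= c by lra.
(* At x0 both v and the memory are at most eta, so the equation itself bounds v1 there. *)
have v1x0 : `|v1 x0| <= (c * b * eta + c * q * eta + b * n) / ga.
  rewrite ler_pdivlMr// mulrC -[X in X * _](gtr0_norm ga0) -normrM eqr; last lra.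
  apply: le_trans (ler_normB _ _) _.
  have Ix0 : `|gauss_memory k v2 x0| <= eta.
    apply: le_trans vi; apply: gauss_primitive_le (profile_int pv); lra.
  have h1 : `|x0 * q * gauss_memory k v2 x0| <= c * q * eta.
    exact: normr_scaled_le x00 x0c q0 Ix0.
  have h2 : `|x0 * b * v x0| <= c * b * eta.
    exact: normr_scaled_le x00 x0c (ltW b0) vx0.
  have h3 := rf x0 ltac:(lra).
  have := ler_normB (x0 * b * v x0) (b * (x0 * f x0)); lra.
have vM (r M : R) : x0 <= r <= r0 -> 0 <= M ->
    (forall x, x0 <= x <= r -> `|v1 x| <= M * expR (lam * (x - x0))) ->
    `|v r| <= eta + M / lam * expR (lam * (r - x0)).
  move=> rr0 M0 bM.
  have : `|v r - v x0| <= M / lam * expR (lam * (r - x0)).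
    apply: (increment_le_expR (dg := v1)) => //; first lra.
    - apply: derivable_within_continuous => x; rewrite in_itv/= => xr.
      by have [] := profile_d1 pv (x := x) ltac:(lra).
    - by move=> x xr; apply: (profile_d1 pv); lra.
    - by move=> x xr; apply: bM; lra.
  have : `|v r| - `|v x0| <= `|v r - v x0|.
    by rewrite (le_trans (ler_norm _))// ler_dist_dist.
  lra.
have cw : {within `[x0, r0], continuous (fun x => `|v1 x| * expR (- (lam * (x - x0))))}.
  have cx x : a < x < c -> {for x, continuous (fun x => `|v1 x| * expR (- (lam * (x - x0))))}.
    move=> xac; apply: continuousM.
      apply: continuous_comp; last exact: norm_continuous.
      apply: differentiable_continuous; apply/derivable1_diffP.
      by have [] := profile_d2 pv xac.
    apply: differentiable_continuous; apply/derivable1_diffP.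
    by [].
  apply: continuous_in_subspaceT => x; rewrite inE/= in_itv/= => xx; apply: cx; lra.
(* The weighted maximum M is attained at m, so the equation at this one point yields an inequality
   for M itself. *)
have [m mx mmax] := EVT_max x0r0 cw.
set M := `|v1 m| * expR (- (lam * (m - x0))) in mmax.
have M0 : 0 <= M by rewrite mulr_ge0 ?expR_ge0.
have v1M x : x0 <= x <= r0 -> `|v1 x| <= M * expR (lam * (x - x0)).
  move=> xx; have := mmax x; rewrite in_itv/= => /(_ xx) h.
  have := ler_wpM2r (expR_ge0 (lam * (x - x0))) h.
  by rewrite -mulrA -expRD addNr expR0 mulr1.
have mr0 : x0 <= m <= r0 by rewrite in_itv/= in mx.
have mac : a < m < c by lra.
have m0 : 0 <= m by lra.
have mc : m <= c by lra.
set E := expR (lam * (m - x0)).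
have E1 : 1 <= E by rewrite -[leLHS]expR0 ler_expR mulr_ge0//; lra.
have ME : M * E = `|v1 m| by rewrite /M /E -mulrA -expRD addNr expR0 mulr1.
have key : ga * (M * E) <= P + ga * (M * E) / 2.
  have v1M' x : x0 <= x <= m -> `|v1 x| <= M * expR (lam * (x - x0)).
    by move=> xm; apply: v1M; lra.
  have vm := vM m M mr0 M0 v1M'.
  have := gauss_memory_near_derive k a0 pv lam0 M0 ax0 (proj1 (andP mr0))
    (proj2 (andP mac)) vi v1M'.
  move: vm; rewrite -/E.
  have -> : 2 * c * k ^+ 2 * M / lam * E = 2 * c * k ^+ 2 * (M / lam * E) by ring.
  set W := M / lam * E.
  have WE : D * W = ga * (M * E) / 2.
    rewrite /W lamE; field; lra.
  move=> vm gm.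
  have h1 : `|m * b * v m| <= c * b * (eta + W).
    exact: normr_scaled_le m0 mc (ltW b0) vm.
  have h2 : `|m * q * (gauss_memory k v2 m - v1 m)| <=
      c * q * (eta + `|v1 x0| + 2 * c * k ^+ 2 * W).
    exact: normr_scaled_le m0 mc q0 gm.
  have h3 := rf m mac.
  have h4 : c * q * `|v1 x0| <= c * q * ((c * b * eta + c * q * eta + b * n) / ga).
    exact: ler_wpM2l (mulr_ge0 (ltW c0) q0) _ _ v1x0.
  (* The leading part v1 of the memory moves to the left, where its sign is favourable: ga + m * q
     >= ga. *)
  have e1 : (ga + m * q) * v1 m = m * b * v m - b * (m * f m) -
      m * q * (gauss_memory k v2 m - v1 m).
    by rewrite mulrDl eqr//; ring.
  have e2 : ga * (M * E) <= `|(ga + m * q) * v1 m|.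
    have mq0 := mulr_ge0 m0 q0.
    by rewrite ME normrM ler_wpM2r// (ger0_norm (addr_ge0 (ltW ga0) mq0)) lerDl.
  apply: le_trans e2 _; rewrite e1.
  have := ler_normB (m * b * v m - b * (m * f m)) (m * q * (gauss_memory k v2 m - v1 m)).
  have := ler_normB (m * b * v m) (b * (m * f m)).
  move=> t1 t2; rewrite -WE PE /D; lra.
have MP : M <= 2 * P / ga.
  apply: (@le_trans _ _ (M * E)); first by rewrite ler_peMr.
  rewrite ler_pdivlMr//; lra.
apply: le_trans (vM r0 M _ M0 v1M) _; first by rewrite x0r0 lexx.
rewrite lerD2l; apply: ler_pM; rewrite ?expR_ge0//.
- by rewrite divr_ge0// ltW.
- by rewrite ler_pM2r// invr_gt0.
- by rewrite ler_expR ler_pM2l//; lra.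
Qed.

(** The starting point x0 is taken so close to a that v and the integral of |v2| are at most eta
    there; the contribution of eta then tends to 0 with x0. C is fixed before the profile, hence
    will not depend on time. *)
Lemma profile_estimate {R : realType} (a c k b ga q : R) :
  0 <= a -> a < c -> 0 < b -> 0 < ga -> 0 <= q ->
  exists2 C, 0 < C & forall (n : R) (v v1 v2 f : R -> R),
    profile a c v v1 v2 ->
    (forall r, a < r < c ->
      b * (v r - f r) = ga / r * v1 r + q * gauss_memory k v2 r) ->
    (forall r, a < r < c -> r * `|f r| <= n) ->
    forall r, a < r < c -> `|v r| <= C * n.
Proof.
move=> a0 ac b0 ga0 q0.
pose lam := 2 * (c * b + 2 * c ^+ 2 * q * k ^+ 2) / ga.
have c0 : 0 < c by lra.
have lam0 : 0 < lam.
  rewrite divr_gt0// mulr_gt0// ltr_pwDl ?mulr_gt0// mulr_ge0 ?sqr_ge0// mulr_ge0//.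
  by rewrite mulr_ge0 ?sqr_ge0.
pose E := 2 / ga / lam * expR (lam * c).
have E0 : 0 < E by rewrite mulr_gt0 ?expR_gt0// divr_gt0// divr_gt0.
(* K and the witness for C are the coefficients of eta and of n in the bound of
   [profile_estimate_from]. *)
pose K := 1 + E * (c * b + c * q + c * q * ((c * b + c * q) / ga)).
have cq0 := mulr_ge0 (ltW c0) q0.
have cb0 := mulr_ge0 (ltW c0) (ltW b0).
have bg0 := mulr_ge0 cq0 (divr_ge0 (ltW b0) (ltW ga0)).
have K0 : 0 < K.
  apply: ltr_pwDl => //; apply: mulr_ge0 (ltW E0) _; apply: addr_ge0; first exact: addr_ge0.
  exact: mulr_ge0 cq0 (divr_ge0 (addr_ge0 cb0 cq0) (ltW ga0)).
exists (E * (b + c * q * (b / ga))); first by rewrite mulr_gt0// ltr_pwDl.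
move=> n v v1 v2 f pv eqv fn r rac; apply/ler_addgt0Pl => e e0.
pose eta := e / K.
have eta0 : 0 < eta by rewrite divr_gt0.
have [d d0 dP] := profile_bdry pv eta0.
have [d' d'0 d'P] := primitive_norm_small a0 (profile_int pv) (profile_ext pv) eta0.
pose x0 := Num.min (Num.min (a + d / 2) (a + d' / 2)) r.
have x01 : x0 <= a + d / 2 by rewrite !ge_min lexx.
have x02 : x0 <= a + d' / 2 by rewrite !ge_min lexx orbT.
have x0r : x0 <= r by rewrite ge_min lexx orbT.
have ax0 : a < x0 by rewrite !lt_min; apply/andP; split; [apply/andP; split|]; lra.
have := profile_estimate_from a0 b0 ga0 q0 (ltW eta0) pv eqv fn ax0 x0r ltac:(lra)
  (dP x0 ltac:(lra) ltac:(lra)) (d'P x0 ltac:(lra) ltac:(lra)) erefl erefl.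
rewrite -/lam => /le_trans; apply.
rewrite [leLHS](_ : _ = K * eta + E * (b + c * q * (b / ga)) * n).
  by rewrite /eta mulrC divfK// gt_eqF.
by rewrite /K /E; field; rewrite !gt_eqF.
Qed.

(** * Boundary values of functions in H^1_0 *)

Section BoundaryValue.
Context {R : realType}.
Notation mu := (@lebesgue_measure R).

(** The identity holds in the extended reals, so it applies to [H1_norm_sq] before the squares are
    known to be integrable. *)
Lemma Lnorm2_sqr (u : R -> R) :
  ('N[mu]_2%:E[EFin \o u] ^+ 2 = \int[mu]_x (u x ^+ 2)%:E)%E.
Proof.
have := @poweR_Lnorm _ _ _ mu (EFin \o u) 2 (lt0r_neq0 (ltr0n _ 2)).
under [in X in _ = X -> _]eq_integral => x _.
  rewrite /= powR_mulrn ?normr_ge0// real_normK ?num_real//.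
  over.
move=> <-; have := Lnorm_ge0 mu 2%:E (EFin \o u).
case: ('N[mu]_2%:E[EFin \o u])%E => [r r0||//].
- by rewrite poweR_EFin powR_mulrn -?lee_fin// EFin_expe.
- by rewrite poweRyr ?expe2 ?mulyy// gt_eqF.
Qed.

Lemma integrable_of_sqr (u : R -> R) (M : \bar R) : measurable_fun setT u ->
  (\int[mu]_x (u x ^+ 2)%:E < M)%E ->
  mu.-integrable setT (EFin \o (fun x => u x ^+ 2)).
Proof.
move=> mu_ uM; apply/integrableP; split.
  by apply/measurable_EFinP; apply: measurable_funX.
apply: (@le_lt_trans _ _ (\int[mu]_x (u x ^+ 2)%:E)%E); last exact: lt_le_trans (leey M).
by under eq_integral do rewrite /= ger0_norm ?sqr_ge0//.
Qed.

Lemma le_Rintegral_subset (A : set R) (u : R -> R) : measurable A ->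
  (forall x, 0 <= u x) -> mu.-integrable setT (EFin \o u) ->
  \int[mu]_(x in A) u x <= \int[mu]_x u x.
Proof.
move=> mA u0 ui; rewrite /Rintegral fine_le//.
- by apply: integrable_fin_num => //; apply: integrableS ui.
- exact: integrable_fin_num.
- apply: ge0_subset_integral => //=; first exact: measurable_int ui.
  by move=> x _; rewrite lee_fin.
Qed.

Lemma test_function_derive1 (Omega : set R) (phi : R -> R) (x : R) :
  test_function Omega phi -> is_derive x 1 phi (derive1 phi x).
Proof. by move=> [dphi _]; rewrite derive1E; exact/derivableP/(dphi 0%N). Qed.

Lemma test_function_continuous_derive1 (Omega : set R) (phi : R -> R) :
  test_function Omega phi -> continuous (derive1 phi).
Proof.
move=> [dphi _] x; apply: differentiable_continuous; apply/derivable1_diffP.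
exact: (dphi 1%N x).
Qed.

Lemma integrable_itv_continuous (b0 b1 : bool) (a x : R) (u : R -> R) :
  continuous u ->
  mu.-integrable [set` Interval (BSide b0 a) (BSide b1 x)] (EFin \o u).
Proof.
move=> cu.
have : mu.-integrable `[a, x] (EFin \o u).
  apply: continuous_compact_integrable; first exact: segment_compact.
  exact: continuous_subspaceT.
apply: integrableS => //; apply: subset_itv; rewrite bnd_simp; case: b0 b1 => [] [];
  by rewrite bnd_simp.
Qed.

(* |y| <= s y^2 + 1 / (4 s) plays the role of the Cauchy-Schwarz inequality. *)
Lemma test_function_le (Omega : set R) (phi : R -> R) (a x s : R) :
  test_function Omega phi -> ~ Omega a -> a < x -> 0 < s ->
  `|phi x| <=
    s * \int[mu]_(y in `]a, x[) (derive1 phi y ^+ 2) + (x - a) / (4 * s).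
Proof.
move=> tphi na ax s0.
have cphi := test_function_continuous_derive1 tphi.
have phia : phi a = 0.
  by have [_ [K [_ KO K0]]] := tphi; apply: K0 => /KO.
have ftc : (\int[mu]_(y in `[a, x]) (derive1 phi y)%:E = (phi x)%:E - (phi a)%:E)%E.
  apply: continuous_FTC2 => //; first exact: continuous_subspaceT.
  have cph y : {for y, continuous phi}.
    apply: differentiable_continuous; apply/derivable1_diffP.
    by have [] := test_function_derive1 y tphi.
  split; first by move=> y _; have [] := test_function_derive1 y tphi.
    exact/cvg_at_right_filter/cph.
  exact/cvg_at_left_filter/cph.
have int_cont (u : R -> R) : continuous u -> mu.-integrable `]a, x[ (EFin \o u).
  exact: integrable_itv_continuous.
have -> : phi x = \int[mu]_(y in `]a, x[) derive1 phi y.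
  rewrite Rintegral_itv_bndo_bndc; last exact: int_cont.
  rewrite Rintegral_itv_obnd_cbnd; last exact: integrable_itv_continuous.
  by rewrite /Rintegral ftc phia sube0.
have i1 := int_cont _ cphi.
have c2 : continuous (fun y => derive1 phi y ^+ 2).
  by move=> y; exact: (continuousM (cphi y) (cphi y)).
have i2 := int_cont _ c2.
have i3 : mu.-integrable `]a, x[ (EFin \o (fun y => s * derive1 phi y ^+ 2)).
  by apply: (@integrable_mulBl _ _ (cst s) _ `|s|) i2.
have i4 : mu.-integrable `]a, x[ (EFin \o cst ((4 * s)^-1 : R)).
  by apply: int_cont => y; exact: cvg_cst.
apply: le_trans (le_normr_Rintegral _ i1) _ => //.
have -> : (x - a) / (4 * s) = \int[mu]_(y in `]a, x[) (4 * s)^-1.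
  rewrite Rintegral_cst//= lebesgue_measure_itv/= lte_fin ax mulrC.
  by rewrite -EFinD.
rewrite -RintegralZl// -RintegralD//.
apply: le_Rintegral => //.
- exact: integrable_norm i1.
- exact: integrable_fun_add.
- move=> y _; rewrite -(real_normK (num_real (derive1 phi y))).
  set z := `|_|; rewrite -subr_ge0.
  have -> : s * z ^+ 2 + (4 * s)^-1 - z = s * (z - (2 * s)^-1) ^+ 2.
    by field; rewrite gt_eqF.
  by rewrite mulr_ge0 ?sqr_ge0// ltW.
Qed.

(* If |f| > m near a, then test functions close to f in H^1 are small near a and
   hence far from f in L^2. *)
Lemma H10_frequently_small (Omega : set R) (f : R -> R) (a c m : R) :
  measurable Omega -> H10 Omega f -> ~ Omega a -> a < c ->
  [set` `]a, c[] `<=` Omega -> 0 < m ->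
  exists2 x, a < x < c & `|f x| <= m.
Proof.
move=> mO [g [Lf Lg _ approx]] na ac acO m0; apply: contrapT => nex.
have fm x : a < x < c -> m < `|f x|.
  by move=> xac; rewrite ltNge; apply/negP => fx; apply: nex; exists x.
have mf : measurable_fun setT (f \_ Omega).
  by have := sub_Lfun_mfun Lf; rewrite inE.
have mg : measurable_fun setT (g \_ Omega).
  by have := sub_Lfun_mfun Lg; rewrite inE.
pose W x := (g \_ Omega) x ^+ 2.
have Wi : mu.-integrable setT (EFin \o W) := Lfun2_integrable_sqr Lg.
pose G := \int[mu]_x W x.
have G0 : 0 <= G by apply: Rintegral_ge0 => x _; exact: sqr_ge0.
(* The constants make each term of [test_function_le] at most m / 4: s * 2 * (1 + G) = m / 4, and x
   - a < eta <= m * s. *)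
pose s := m / (8 * (1 + G)).
have s0 : 0 < s by rewrite divr_gt0// mulr_gt0// ltr_pwDl.
pose eta := Num.min ((c - a) / 2) (m * s).
have eta0 : 0 < eta by rewrite lt_min; apply/andP; split; [lra | exact: mulr_gt0].
have eta1 : eta <= (c - a) / 2 by rewrite ge_min lexx.
have eta2 : eta <= m * s by rewrite ge_min lexx orbT.
(* Where |f| > m and |phi| <= m / 2, the square of f - phi is at least m^2 / 4; del is the integral
   of this over ]a, a + eta[. The bound eps <= 1 serves to control the integral of U by 1. *)
pose del := eta * (m ^+ 2 / 4).
have del0 : 0 < del by rewrite mulr_gt0// divr_gt0// exprn_gt0.
pose eps := Num.min 1 del.
have eps0 : 0 < eps by rewrite lt_min ltr01.
have eps1 : eps <= 1 by rewrite ge_min lexx.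
have epsd : eps ^+ 2 <= del.
  apply: (@le_trans _ _ eps); last by rewrite ge_min lexx orbT.
  by rewrite expr2 ler_piMl// ltW.
have [phi tphi] := approx eps eps0.
rewrite /H1_norm_sq !Lnorm2_sqr => close.
have cphi : continuous phi.
  move=> y; apply: differentiable_continuous; apply/derivable1_diffP.
  by have [] := test_function_derive1 y tphi.
have cphi1 := test_function_continuous_derive1 tphi.
have mB (u w : R -> R) : measurable_fun setT (u \_ Omega) -> continuous w ->
    measurable_fun setT ((u \- w) \_ Omega).
  move=> mu_ cw; apply/(measurable_restrictT _ mO).
  apply: measurable_funB; first exact/(measurable_restrictT _ mO).
  by apply: measurable_funTS; exact: continuous_measurable_fun.
pose V x := ((f \- phi) \_ Omega) x ^+ 2.
pose U x := ((g \- derive1 phi) \_ Omega) x ^+ 2.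
have int_ge0 (u : R -> R) : (0 <= \int[mu]_x (u x ^+ 2)%:E)%E.
  by apply: integral_ge0 => x _; rewrite lee_fin sqr_ge0.
have Vlt : (\int[mu]_x (V x)%:E < (eps ^+ 2)%:E)%E.
  by apply: le_lt_trans close; rewrite leeDl.
have Ult : (\int[mu]_x (U x)%:E < (eps ^+ 2)%:E)%E.
  by apply: le_lt_trans close; rewrite leeDr.
have Vi : mu.-integrable setT (EFin \o V) by exact: integrable_of_sqr (mB _ _ mf cphi) Vlt.
have Ui : mu.-integrable setT (EFin \o U) by exact: integrable_of_sqr (mB _ _ mg cphi1) Ult.
have VR : \int[mu]_x V x < eps ^+ 2.
  by rewrite -lte_fin /Rintegral fineK//; exact: integrable_fin_num.
have UR : \int[mu]_x U x < eps ^+ 2.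
  by rewrite -lte_fin /Rintegral fineK//; exact: integrable_fin_num.
have phi_small x : a < x < a + eta -> `|phi x| <= m / 2.
  move=> xa; have ax : a < x by lra.
  have axO : [set` `]a, x[] `<=` Omega.
    apply: subset_trans acO; apply: subset_itvl; rewrite bnd_simp; lra.
  apply: le_trans (test_function_le tphi na ax s0) _.
  have sub (u : R -> R) : mu.-integrable setT (EFin \o u) ->
      mu.-integrable `]a, x[ (EFin \o u) by apply: integrableS.
  have UWi : mu.-integrable `]a, x[ (EFin \o (fun y => U y + W y)).
    by apply: integrable_fun_add => //; exact: sub.
  have UW2i : mu.-integrable `]a, x[ (EFin \o (fun y => 2 * (U y + W y))).
    by apply: (@integrable_mulBl _ _ (cst 2) _ `|2|) UWi.
  have le1 : \int[mu]_(y in `]a, x[) (derive1 phi y ^+ 2) <=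
      \int[mu]_(y in `]a, x[) (2 * (U y + W y)).
    apply: le_Rintegral => //.
      apply: integrable_itv_continuous => y.
      exact: (continuousM (cphi1 y) (cphi1 y)).
    move=> y yax; rewrite /U /W !patchE mem_set; last exact: axO.
    rewrite /= -subr_ge0.
    have -> : 2 * ((g y - derive1 phi y) ^+ 2 + g y ^+ 2) - derive1 phi y ^+ 2 =
      (2 * g y - derive1 phi y) ^+ 2 by ring.
    exact: sqr_ge0.
  have le2 : \int[mu]_(y in `]a, x[) (2 * (U y + W y)) <= 2 * (1 + G).
    rewrite RintegralZl// ler_wpM2l// RintegralD//; try exact: sub.
    apply: lerD.
      apply: le_trans (le_Rintegral_subset _ _ Ui) _ => //.
        by move=> y; exact: sqr_ge0.
      apply: le_trans (ltW UR) _; rewrite expr2.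
      exact: le_trans (ler_piMl (ltW eps0) eps1) eps1.
    by apply: le_Rintegral_subset => // y; exact: sqr_ge0.
  have le3 := ler_wpM2l (ltW s0) (le_trans le1 le2).
  have e1 : s * (2 * (1 + G)) = m / 4.
    by rewrite /s; field; rewrite gt_eqF// ltr_pwDl.
  have le4 : (x - a) / (4 * s) <= m / 4.
    rewrite ler_pdivrMr; last by rewrite mulr_gt0.
    have -> : m / 4 * (4 * s) = m * s by field.
    lra.
  lra.
suff : del <= \int[mu]_x V x by lra.
have -> : del = \int[mu]_(y in `]a, (a + eta)%R[) (m ^+ 2 / 4).
  rewrite Rintegral_cst//= lebesgue_measure_itv/= lte_fin ltrDl eta0 mulrC.
  by rewrite -EFinD/= addrAC subrr add0r.
apply: le_trans (le_Rintegral_subset (A := [set` `]a, a + eta[]) _ _ Vi) => //; last first.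
  by move=> y; exact: sqr_ge0.
apply: le_Rintegral => //.
- by apply: integrable_itv_continuous => y; exact: cvg_cst.
- exact: integrableS Vi.
- move=> y; rewrite /= in_itv/= => ya.
  rewrite /V patchE mem_set; last by apply: acO; rewrite /= in_itv/=; lra.
  have := phi_small y ya; have := fm y ltac:(lra); rewrite /= => h1 h2.
  have h3 : m / 2 <= `|f y - phi y|.
    have : `|f y| - `|phi y| <= `|f y - phi y|.
      by rewrite (le_trans (ler_norm _))// ler_dist_dist.
    lra.
  rewrite -(real_normK (num_real (f y - phi y))).
  have -> : m ^+ 2 / 4 = (m / 2) ^+ 2 by field.
  by rewrite lerXn2r// nnegrE; lra.
Qed.

End BoundaryValue.

(** * The exponential memory in time *)

(* By parts, this is k times the primitive of exp (k s) * u s when u 0 = 0; this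
   form avoids integrating u itself. *)
Definition memory_gap {R : realType} (k : R) (u d : R -> R) (t : R) : R :=
  expR (k * t) * u t -
  \int[lebesgue_measure]_(s in `]0, t[) (expR (k * s) * d s).

Record evolution {R : realType} (T : R) (u d : R -> R) : Prop := {
  evolution_init : u 0 = 0 ;
  evolution_cont : {within `[0, T[, continuous u} ;
  evolution_deriv : forall t, 0 < t < T -> is_derive t 1 u (d t) ;
  evolution_C1 : forall t, 0 < t < T -> {for t, continuous d} ;
  evolution_int : forall t, 0 < t < T ->
    (@lebesgue_measure R).-integrable `]0, t[ (EFin \o d) }.

Section MemoryGap.
Context {R : realType}.
Notation mu := (@lebesgue_measure R).
Implicit Types (k T t : R) (u d : R -> R).

Let continuous_exp k : continuous (fun s : R => expR (k * s)).
Proof.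
move=> s; apply: differentiable_continuous; apply/derivable1_diffP.
by [].
Qed.

Let integrable_exp k T u d t : 0 <= k -> evolution T u d -> 0 < t < T ->
  mu.-integrable `]0, t[ (EFin \o (fun s => expR (k * s) * d s)).
Proof.
move=> k0 ev tT.
apply: (@integrable_mulBl _ _ _ _ (expR (k * t))) (evolution_int ev tT) => //.
  by apply: measurable_funTS; exact: continuous_measurable_fun.
move=> s; rewrite /= in_itv/= => st.
by rewrite ger0_norm ?expR_ge0// ler_expR ler_wpM2l//; lra.
Qed.

Lemma memory_gap0 k u d : u 0 = 0 -> memory_gap k u d 0 = 0.
Proof. by move=> u0; rewrite /memory_gap u0 mulr0 set_itvoo0 Rintegral_set0 subrr. Qed.

(** The two terms with d cancel, so the derivative involves u alone; this is what closes the
    evolution in time. *)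
Lemma is_derive_memory_gap k T u d t : 0 <= k -> evolution T u d -> 0 < t < T ->
  is_derive t 1 (memory_gap k u d) (k * (expR (k * t) * u t)).
Proof.
move=> k0 ev tT; pose t' := (t + T) / 2.
have d1 : is_derive t 1 (fun y => \int[mu]_(s in `]0, y[) (expR (k * s) * d s))
    (expR (k * t) * d t).
  apply: (is_derive_primitive (c := t')); first by rewrite /t'; lra.
    by apply: (integrable_exp k0 ev); rewrite /t'; lra.
  by apply: continuousM; [exact: continuous_exp | exact: (evolution_C1 ev)].
have d2 := evolution_deriv ev tT.
by apply: is_derive_eq; rewrite /GRing.scale/=; ring.
Qed.

(** Away from 0 the function is differentiable. At 0 its first term is small by continuity of u, the
    second by absolute continuity of the integral. *)
Lemma continuous_memory_gap k T u d : 0 <= k -> evolution T u d ->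
  {within `[0, T[, continuous (memory_gap k u d)}.
Proof.
move=> k0 ev; have u0 := evolution_init ev.
apply/subspace_continuousP => t; rewrite /= in_itv/= => tT.
have [t0|t0] := eqVneq (t : R) 0; last first.
  apply: cvg_within_filter; apply: differentiable_continuous.
  apply/derivable1_diffP; have [] // := is_derive_memory_gap k0 ev (t := t).
  by rewrite lt_neqAle eq_sym t0.
have T0 : 0 < T by lra.
apply/cvgrPdist_le => e e0.
have e20 : 0 < e / 2 by lra.
have T20 : 0 < T / 2 < T by lra.
have [|d2 d20 d2P] := primitive_norm_small (lexx 0) (integrable_exp k0 ev T20) _ e20.
  by move=> x; lra.
have [d1 d10 d1P] := within_continuous_dist (e := e / 2 / expR (k * T))
  (evolution_cont ev)
  (x := 0) ltac:(by rewrite /= in_itv/= lexx; lra) ltac:(by rewrite divr_gt0 ?expR_gt0).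
exists (Num.min (Num.min d1 d2) (T / 2)); first by rewrite /= !lt_min d10 d20; lra.
rewrite t0 /from_subspace memory_gap0// => {t0 tT}t /=.
rewrite !lt_min [in X in X -> _]sub0r normrN => /andP[/andP[td1 td2] tT2].
rewrite in_itv/= => tT'; rewrite sub0r normrN.
have [->|t0] := eqVneq t 0; first by rewrite memory_gap0// normr0; lra.
have tgt : 0 < t by rewrite lt_neqAle eq_sym t0; lra.
rewrite gtr0_norm// in td2 tT2.
apply: le_trans (ler_normB _ _) _.
have h1 : `|expR (k * t) * u t| <= e / 2.
  have := d1P t ltac:(by rewrite /= in_itv/=); rewrite subr0 u0 subr0 => /(_ td1) ut.
  rewrite normrM ger0_norm ?expR_ge0//.
  have -> : e / 2 = expR (k * T) * (e / 2 / expR (k * T)).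
    by field; rewrite gt_eqF// expR_gt0.
  apply: ler_pM; [exact: expR_ge0 | exact: normr_ge0 | | exact: ltW].
  by rewrite ler_expR ler_wpM2l//; lra.
have h2 : `|\int[mu]_(s in `]0, t[) (expR (k * s) * d s)| <= e / 2.
  apply: le_trans (le_normr_Rintegral _ _) _ => //.
    by apply: (integrable_exp k0 ev); lra.
  by apply: d2P; lra.
lra.
Qed.

Lemma memory_gapE k T u d t : 0 <= k -> evolution T u d -> 0 < t < T ->
  \int[mu]_(s in `]0, t[) (d s * expR (- k * (t - s))) =
  u t - expR (- (k * t)) * memory_gap k u d t.
Proof.
move=> k0 ev tT; rewrite /memory_gap mulrBr mulrA -expRD addNr expR0 mul1r.
rewrite opprB addrCA subrr addr0 -RintegralZl//; last exact: (integrable_exp k0 ev).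
apply: eq_Rintegral => s _; rewrite mulrA -expRD mulrC; congr (expR _ * _); ring.
Qed.

End MemoryGap.

(** * Solutions at a fixed time as profiles in r *)

Section Profiles.
Context {R : realType}.
Notation mu := (@lebesgue_measure R).
Implicit Types (a b c : R) (v : R -> R).

(** The difference of v1 and the primitive of v2 is constant, so v1 stays within 2 V of its value at
    the midpoint, V being the integral of |v2|. *)
Lemma derivative_bounded a c (v1 v2 : R -> R) : 0 <= a -> a < c ->
  (forall x, a < x < c -> is_derive x 1 v1 (v2 x)) ->
  (forall x, a < x < c -> {for x, continuous v2}) ->
  mu.-integrable `]0, c[ (EFin \o v2) ->
  exists2 B, 0 <= B & forall x, a < x < c -> `|v1 x| <= B.
Proof.
move=> a0 ac dv1 cv2 vi.
pose Psi x := \int[mu]_(y in `]0, x[) v2 y.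
pose g := Psi - v1.
have dg x : a < x < c -> is_derive x 1 g 0.
  move=> xac; have d1 : is_derive x 1 Psi (v2 x).
    by apply: (is_derive_primitive (c := c)) => //; [lra | exact: cv2].
  have d2 := dv1 x xac.
  by apply: is_derive_eq; rewrite subrr.
have constg x y : a < x -> x <= y -> y < c -> g y = g x.
  move=> ax xy yc; apply/eqP; rewrite -subr_eq0 -normr_le0.
  rewrite -(mul0r (y - x)); apply: (increment_le_linear (dg := fun=> 0)) => //.
  - apply: derivable_within_continuous => z; rewrite in_itv/= => zz.
    by have [] := dg z ltac:(lra).
  - by move=> z zz; apply: dg; lra.
  - by move=> z _; rewrite normr0.
pose x0 := (a + c) / 2.
pose V := \int[mu]_(y in `]0, c[) `|v2 y|.
have PsiV x : x < c -> `|Psi x| <= V.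
  by move=> xc; apply: normr_primitive_le vi; exact: ltW.
exists (`|v1 x0| + 2 * V).
  by rewrite addr_ge0// mulr_ge0//; apply: Rintegral_ge0.
move=> x xac; have : g x = g x0.
  have [xx0|xx0] := lerP x x0; first by apply/esym/constg => //; rewrite /x0; lra.
  by apply: constg (ltW xx0) _; rewrite /x0; lra.
rewrite /g /= -![(_ - _) _]/(_ _ - _ _) => gx.
have -> : v1 x = Psi x - Psi x0 + v1 x0.
  have : Psi x - v1 x = Psi x0 - v1 x0 by [].
  lra.
have p1 := PsiV x ltac:(lra); have p2 := PsiV x0 ltac:(rewrite /x0; lra).
have := ler_normD (Psi x - Psi x0) (v1 x0).
have := ler_normB (Psi x) (Psi x0); lra.
Qed.

Lemma lipschitz_of_derivative a c B v (v1 : R -> R) :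
  (forall x, a < x < c -> is_derive x 1 v (v1 x)) ->
  (forall x, a < x < c -> `|v1 x| <= B) ->
  forall x y, a < x -> x <= y -> y < c -> `|v y - v x| <= B * (y - x).
Proof.
move=> dv vB x y ax xy yc; apply: (increment_le_linear (dg := v1)) => //.
- apply: derivable_within_continuous => z; rewrite in_itv/= => zz.
  by have [] := dv z ltac:(lra).
- by move=> z zz; apply: dv; lra.
- by move=> z zz; apply: vB; lra.
Qed.

Lemma profile_sub a c (v v1 v2 w w1 w2 : R -> R) :
  profile a c v v1 v2 -> profile a c w w1 w2 ->
  profile a c (fun x => v x - w x) (fun x => v1 x - w1 x) (fun x => v2 x - w2 x).
Proof.
move=> pv pw; split.
- move=> x xac; have d1 := profile_d1 pv xac; have d2 := profile_d1 pw xac.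
  exact: is_deriveB.
- move=> x xac; have d1 := profile_d2 pv xac; have d2 := profile_d2 pw xac.
  exact: is_deriveB.
- by move=> x xac; apply: continuousB; [exact: (profile_cont pv) | exact: (profile_cont pw)].
- by apply: integrable_fun_sub => //; [exact: (profile_int pv) | exact: (profile_int pw)].
- by move=> x xa; rewrite (profile_ext pv)// (profile_ext pw)// subrr.
- move=> e e0; have e20 : 0 < e / 2 by lra.
  have [d d0 dP] := profile_bdry pv e20; have [d' d'0 d'P] := profile_bdry pw e20.
  exists (Num.min d d'); first by rewrite lt_min d0.
  move=> x xad xc; apply: le_trans (ler_normB _ _) _.
  have : x < a + d by apply: lt_le_trans (proj2 (andP xad)) _; rewrite lerD2l ge_min lexx.
  have : x < a + d'.
    by apply: lt_le_trans (proj2 (andP xad)) _; rewrite lerD2l ge_min lexx orbT.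
  move=> h1 h2; have := dP x ltac:(lra) xc; have := d'P x ltac:(lra) xc; lra.
Qed.

(** Solving the equation for r * f r leaves bounded terms, as the factor r removes the singularity
    of ga / r. The bound may depend on the profile; it serves to make the norm finite at each
    time. *)
Lemma profile_source_bounded a c k b ga q (v v1 v2 f : R -> R) :
  0 <= a -> a < c -> 0 < b -> 0 < ga -> 0 <= q -> profile a c v v1 v2 ->
  (forall r, a < r < c ->
    b * (v r - f r) = ga / r * v1 r + q * gauss_memory k v2 r) ->
  exists B, forall r, a < r < c -> r * `|f r| <= B.
Proof.
move=> a0 ac b0 ga0 q0 pv eqv.
have [B B0 v1B] := derivative_bounded a0 ac (profile_d2 pv) (profile_cont pv) (profile_int pv).
have lip := lipschitz_of_derivative (profile_d1 pv) v1B.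
pose x0 := (a + c) / 2.
pose A := `|v x0| + B * (c - a).
have vA x : a < x < c -> `|v x| <= A.
  move=> xac.
  have : `|v x - v x0| <= B * (c - a).
    have [xx0|xx0] := lerP x x0.
      rewrite distrC; apply: le_trans (lip x x0 _ xx0 _) _; rewrite /x0; try lra.
      by rewrite ler_wpM2l//; lra.
    apply: le_trans (lip x0 x _ (ltW xx0) _) _; rewrite /x0; try lra.
    by rewrite ler_wpM2l//; lra.
  have : `|v x| - `|v x0| <= `|v x - v x0|.
    by rewrite (le_trans (ler_norm _))// ler_dist_dist.
  rewrite /A; lra.
pose V := \int[mu]_(y in `]0, c[) `|v2 y|.
have IV r : r < c -> `|gauss_memory k v2 r| <= V.
  move=> rc; apply: le_trans (gauss_primitive_le k r rc (profile_int pv)) _.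
  have := normr_primitive_le (ltW rc) (integrable_norm (profile_int pv)).
  rewrite ger0_norm; last by apply: Rintegral_ge0 => y _; exact: normr_ge0.
  by under [X in _ <= X]eq_Rintegral do rewrite /= normr_id.
exists (c * A + (ga * B + c * q * V) / b) => r rac.
have r0 : 0 < r by lra.
have c0 : 0 <= c by lra.
have -> : r * `|f r| = `|r * f r| by rewrite normrM (gtr0_norm r0).
have -> : r * f r = r * v r - (ga * v1 r + r * q * gauss_memory k v2 r) / b.
  have -> : ga * v1 r + r * q * gauss_memory k v2 r = r * (b * (v r - f r)).
    by rewrite eqv//; field; rewrite gt_eqF.
  by field; rewrite gt_eqF.
apply: le_trans (ler_normB _ _) _; apply: lerD.
  rewrite normrM (gtr0_norm r0); apply: ler_pM => //; [lra | lra | exact: vA].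
rewrite normrM normfV (gtr0_norm b0) ler_pM2r ?invr_gt0//.
apply: le_trans (ler_normD _ _) _; apply: lerD.
  by rewrite normrM (gtr0_norm ga0) ler_pM2l// v1B.
rewrite [leLHS]normrM; apply: ler_pM => //; last by apply: IV; lra.
by rewrite normrM (gtr0_norm r0) (ger0_norm q0) ler_wpM2r//; lra.
Qed.

(* Here a is the left end point of Omega. *)
Lemma regular_profile (Omega : set R) (T : R) (h : R -> R -> R) a c t :
  open Omega -> 0 <= a -> a < c -> Omega c -> [set` `]a, c[] `<=` Omega ->
  (forall x, 0 < x -> x <= a -> ~ Omega x) -> ~ Omega a ->
  regular Omega T h -> 0 < t < T ->
  profile a c (h^~ t) (derive1 (h^~ t)) (derive1n 2 (h^~ t)).
Proof.
move=> oO a0 ac Oc acO Olow Oa reg tT.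
have inO x : a < x < c -> Omega x by move=> xac; apply: acO; rewrite /= in_itv.
have d1 x : a < x < c -> is_derive x 1 (h^~ t) (derive1 (h^~ t) x).
  by move=> xac; rewrite derive1E; apply/derivableP; exact: (regular_diff_r reg (inO x xac) tT).1.
have d2 x : a < x < c -> is_derive x 1 (derive1 (h^~ t)) (derive1n 2 (h^~ t) x).
  move=> xac; rewrite derive1nS derive1n1 derive1E; apply/derivableP.
  exact: (regular_diff_r reg (inO x xac) tT).2.
have c2 x : a < x < c -> {for x, continuous (derive1n 2 (h^~ t))}.
  move=> xac; have := regular_C2_r reg tT.
  by rewrite continuous_open_subspace// => /(_ x); apply; rewrite inE; exact: inO.
have i2 := regular_int_r reg Oc tT.
split => //.
- move=> x xa.
  have nearx : \forall y \near x, 0 < y < a.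
    have := @near_in_itvoo R 0 a x; rewrite in_itv/= => /(_ xa).
    by apply: filterS => y; rewrite in_itv.
  have h0 y : 0 < y < a -> h y t = 0.
    by move=> ya; apply: (regular_zero_ext reg tT); apply: Olow; lra.
  have h10 y : 0 < y < a -> derive1 (h^~ t) y = 0.
    move=> ya; rewrite derive1E (@near_eq_derive _ _ _ _ (cst 0)) ?derive_cst//.
    have := @near_in_itvoo R 0 a y; rewrite in_itv/= => /(_ ya).
    by apply: filterS => z; rewrite in_itv/= => /h0.
  rewrite derive1nS derive1n1 derive1E (@near_eq_derive _ _ _ _ (cst 0)) ?derive_cst//.
  by apply: filterS nearx => y /h10.
- move=> e e0.
  have [B B0 fB] := derivative_bounded a0 ac d2 c2 i2.
  have lip := lipschitz_of_derivative d1 fB.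
  (* The H^1_0 condition only gives some x' in ]a, x[ where |h| <= e / 2; on this width the
     Lipschitz bound B adds at most e / 2 between x' and x. *)
  exists (e / (2 * (1 + B))); first by rewrite divr_gt0// mulr_gt0// ltr_pwDl.
  move=> x xad xc.
  have axO : [set` `]a, x[] `<=` Omega.
    by move=> y; rewrite /= in_itv/= => yx; apply: inO; lra.
  have [x' x'a x'e] := H10_frequently_small (open_measurable oO)
    (regular_H10 reg tT) Oa (proj1 (andP xad)) axO (m := e / 2) ltac:(lra).
  have := lip x' x ltac:(lra) ltac:(lra) xc.
  have : B * (x - x') <= e / 2.
    apply: (@le_trans _ _ ((1 + B) * (e / (2 * (1 + B))))).
      by apply: ler_pM => //; lra.
    rewrite [leLHS](_ : _ = e / 2)//; field; rewrite gt_eqF//; lra.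
  have : `|h x t| - `|h x' t| <= `|h x t - h x' t|.
    by rewrite (le_trans (ler_norm _))// ler_dist_dist.
  lra.
Qed.

End Profiles.

(** * The difference of two solutions and uniqueness *)

Lemma CF_norm_gt0 {R : realType} (alpha : R) : 0 < alpha < 1 -> 0 < CF_norm alpha.
Proof.
move=> al01; rewrite /CF_norm ltr_pwDl ?divr_ge0//; [lra | lra |].
by apply: Rintegral_ge0 => x _; rewrite mulr_ge0 ?powR_ge0 ?expR_ge0.
Qed.

(** Here a is the infimum of Omega, excluded by openness, and connectedness fills ]a, c[. The point
    c is taken inside Omega because integrability of the second space derivative is given on ]0, c[
    for such c. *)
Lemma open_interval_left_end {R : realType} (Omega : set R) (r : R) :
  radial_domain Omega -> Omega r -> exists a c, [/\ a < r < c, 0 <= a, Omega c,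
    [set` `]a, c[] `<=` Omega & ~ Omega a /\ forall x, 0 < x -> x <= a -> ~ Omega x].
Proof.
move=> [_ oO /connected_intervalP iO _ Opos] Or.
have ball_in x : Omega x -> exists2 e : R, 0 < e & forall y, `|x - y| < e -> Omega y.
  by move=> Ox; have [e /= e0 eP] := open_nbhs_nbhs (conj oO Ox); exists e.
have Ogt0 x : Omega x -> 0 < x by move=> /Opos; rewrite /= in_itv/= andbT.
have infO : has_inf Omega.
  by split; [exists r | exists 0 => x /Ogt0/ltW].
have notlow x : x <= inf Omega -> ~ Omega x.
  move=> xle Ox; have [e e0 eP] := ball_in x Ox.
  have : Omega (x - e / 2).
    by apply: eP; rewrite opprB addrC subrK ger0_norm; lra.
  move=> /(ge_inf infO.2); lra.
have [e e0 eP] := ball_in r Or.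
have Oc : Omega (r + e / 2) by apply: eP; rewrite opprD addrA subrr sub0r normrN ger0_norm; lra.
exists (inf Omega), (r + e / 2); split => //.
- apply/andP; split; last lra.
  by rewrite ltNge; apply/negP => /notlow.
- by apply: lb_le_inf; [exists r | move=> x /Ogt0/ltW].
- move=> x; rewrite /= in_itv/= => /andP[ax xc].
  have [y Oy yx] := inf_adherent (eps := x - inf Omega) ltac:(lra) infO.
  by apply: (iO y (r + e / 2)) => //; lra.
- by split; [exact: notlow | move=> x _; exact: notlow].
Qed.

Lemma regular_evolution {R : realType} (Omega : set R) (T : R)
    (h phi : R -> R -> R) (r : R) :
  regular Omega T h -> regular Omega T phi -> Omega r -> h r 0 = phi r 0 ->
  evolution T (fun t => h r t - phi r t)
    (fun t => derive1 (h r) t - derive1 (phi r) t).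
Proof.
move=> rh rphi Or h0.
have dh f : regular Omega T f -> forall t, 0 < t < T -> is_derive t 1 (f r) (derive1 (f r) t).
  by move=> rf t tT; rewrite derive1E; apply/derivableP; exact: (regular_diff_t rf).
have ch f : regular Omega T f -> forall t, 0 < t < T -> {for t, continuous (derive1 (f r))}.
  move=> rf t tT; have := regular_C1_t rf Or.
  by rewrite continuous_open_subspace// => /(_ t); apply; rewrite inE /= in_itv.
split.
- by rewrite h0 subrr.
- by move=> t; apply: continuousB; [exact: (regular_cont_t rh Or) | exact: (regular_cont_t rphi Or)].
- by move=> t tT; have ? := dh _ rh t tT; have ? := dh _ rphi t tT; exact: is_deriveB.
- by move=> t tT; apply: continuousB; [exact: ch | exact: ch].
- move=> t tT; apply: integrable_fun_sub => //; first exact: (regular_int_t rh).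
  exact: (regular_int_t rphi).
Qed.

(** The exponential weight is at most 1 on ]0, t[, so both integrands are integrable and the
    integrals subtract; [memory_gapE] evaluates the result. *)
Lemma CF_deriv_sub {R : realType} (Omega : set R) (T alpha : R)
    (h phi : R -> R -> R) (r t : R) :
  regular Omega T h -> regular Omega T phi -> Omega r -> 0 < alpha < 1 ->
  h r 0 = phi r 0 -> 0 < t < T ->
  CF_deriv alpha h r t - CF_deriv alpha phi r t =
  CF_norm alpha / (1 - alpha) * (h r t - phi r t -
    expR (- (alpha / (1 - alpha) * t)) * memory_gap (alpha / (1 - alpha))
      (fun s => h r s - phi r s)
      (fun s => derive1 (h r) s - derive1 (phi r) s) t).
Proof.
move=> rh rphi Or al01 h0 tT; set k := alpha / (1 - alpha).
have k0 : 0 <= k by rewrite divr_ge0//; lra.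
rewrite -(memory_gapE k0 (regular_evolution rh rphi Or h0) tT).
rewrite /CF_deriv -/k -mulrBr; congr (_ * _).
have int_exp f : regular Omega T f -> (@lebesgue_measure R).-integrable `]0, t[
    (EFin \o (fun s => derive1 (f r) s * expR (- k * (t - s)))).
  move=> rf.
  under [X in integrable _ _ X]eq_fun do rewrite /= mulrC.
  apply: (@integrable_mulBl _ _ _ _ 1) => //; last exact: (regular_int_t rf).
    apply: measurable_funTS; apply: continuous_measurable_fun => s.
    by apply: differentiable_continuous; apply/derivable1_diffP.
  move=> s; rewrite /= in_itv/= => st.
  by rewrite ger0_norm ?expR_ge0// -[leRHS]expR0 ler_expR mulNr oppr_le0 mulr_ge0//; lra.
rewrite -RintegralB//; [|exact: int_exp|exact: int_exp].
by apply: eq_Rintegral => s _; rewrite mulrBl.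
Qed.

Lemma CF_laplacian_sub {R : realType} (Omega : set R) (T alpha : R)
    (h phi : R -> R -> R) (r t : R) :
  regular Omega T h -> regular Omega T phi -> Omega r -> 0 < t < T ->
  CF_laplacian alpha h r t - CF_laplacian alpha phi r t =
  alpha / ((1 - alpha) * Num.sqrt pi) * gauss_memory (CF_lambda alpha)
    (fun x => derive1n 2 (h^~ t) x - derive1n 2 (phi^~ t) x) r.
Proof.
move=> rh rphi Or tT; rewrite /CF_laplacian -mulrBr; congr (_ * _).
rewrite -RintegralB//; last 2 first.
- exact: (integrable_gauss_kernel (CF_lambda alpha) r (regular_int_r rh Or tT)).
- exact: (integrable_gauss_kernel (CF_lambda alpha) r (regular_int_r rphi Or tT)).
by apply: eq_Rintegral => x _; rewrite /gauss_kernel mulrBr.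
Qed.

Unset Implicit Arguments.

Theorem theorem3p4 (R : realType) (Omega : set R) (T alpha Tr S : R)
    (h0 : R -> R) (h phi : R -> R -> R) :
  radial_domain Omega ->
  0 < T -> 0 < alpha < 1 -> 0 < Tr -> 0 < S ->
  groundwater_solution Omega T alpha Tr S h0 h ->
  groundwater_solution Omega T alpha Tr S h0 phi ->
  forall r t : R, Omega r -> 0 < t < T -> h r t = phi r t.
Proof.
move=> domO T0 al01 Tr0 S0 [rh eqh inith] [rphi eqphi initphi] r t Or tT.
have [a [c [rac a0 Oc acO [Oa Olow]]]] := open_interval_left_end domO Or.
have oO : open Omega by case: domO.
have ac : a < c by lra.
have inO x : a < x < c -> Omega x by move=> xac; apply: acO; rewrite /= in_itv.
have init x : Omega x -> h x 0 = phi x 0 by move=> Ox; rewrite inith// initphi.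
set k := alpha / (1 - alpha).
have k0 : 0 <= k by rewrite divr_ge0//; lra.
pose b := CF_norm alpha / (1 - alpha).
have b0 : 0 < b by rewrite divr_gt0 ?CF_norm_gt0//; lra.
have ga0 : 0 < gamma Tr S by rewrite divr_gt0.
pose q := gamma Tr S * (alpha / ((1 - alpha) * Num.sqrt pi)).
have q0 : 0 <= q.
  apply: mulr_ge0 (ltW ga0) _; apply: divr_ge0; first lra.
  by apply: mulr_ge0 (sqrtr_ge0 _); lra.
pose d x s := derive1 (h x) s - derive1 (phi x) s.
pose F x := memory_gap k (fun s => h x s - phi x s) (d x).
pose f s x := expR (- (k * s)) * F x s.
have prof s : 0 < s < T -> profile a c (fun x => h x s - phi x s)
    (fun x => derive1 (h^~ s) x - derive1 (phi^~ s) x)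
    (fun x => derive1n 2 (h^~ s) x - derive1n 2 (phi^~ s) x).
  by move=> sT; apply: profile_sub;
    [exact: regular_profile rh sT | exact: regular_profile rphi sT].
have eqw s : 0 < s < T -> forall x, a < x < c ->
    b * (h x s - phi x s - f s x) =
    gamma Tr S / x * (derive1 (h^~ s) x - derive1 (phi^~ s) x) +
    q * gauss_memory (CF_lambda alpha)
      (fun y => derive1n 2 (h^~ s) y - derive1n 2 (phi^~ s) y) x.
  move=> sT x xac; have Ox := inO x xac.
  rewrite /b /f /F /d -(CF_deriv_sub rh rphi Ox al01 (init x Ox) sT).
  rewrite eqh// eqphi// /q -[X in _ = _ + X]mulrA -(CF_laplacian_sub alpha rh rphi Ox sT).
  have -> : theta Tr S x = gamma Tr S / x.
    by rewrite /theta /gamma; field; rewrite !gt_eqF//; lra.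
  by rewrite !mulrBr opprD addrACA.
have [C C0 est] := profile_estimate (CF_lambda alpha) a0 ac b0 ga0 q0.
have ev x : a < x < c -> evolution T (fun s => h x s - phi x s) (d x).
  by move=> xac; have Ox := inO x xac; exact: (regular_evolution rh rphi Ox (init x Ox)).
have fF s x n : 0 < s < T -> a < x < c -> `|x * F x s| <= n -> x * `|f s x| <= n.
  move=> sT xac; apply: le_trans.
  rewrite /f !normrM (@gtr0_norm _ x); last lra.
  rewrite ler_wpM2l//; first lra.
  rewrite ler_piMl// ger0_norm ?expR_ge0// -[leRHS]expR0 ler_expR oppr_le0.
  by rewrite mulr_ge0//; lra.
(* The bounds below are uniform in the space variable, but a priori only
   pointwise in time. *)
pose X := {x : R | a < x < c}.
pose G (x : X) s := sval x * F (sval x) s.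
have G0 : forall (x : X) s, 0 <= s < T -> G x s = 0.
  (* The time derivative of G is x * k * exp(k s) * w, where |w| <= C * B by the spatial estimate, x
     < c and s < T; the summand 1 secures positivity of the constant. *)
  apply: (@evolution_eq0 _ _ G
    (fun x s => sval x * (k * (expR (k * s) * (h (sval x) s - phi (sval x) s))))
    T (1 + c * (k * (expR (k * T) * C)))).
  - have c0 : 0 <= c by lra.
    have eC := mulr_ge0 (expR_ge0 (k * T)) (ltW C0).
    by apply: ltr_pwDl => //; exact: mulr_ge0 c0 (mulr_ge0 k0 eC).
  - move=> [x xac]; rewrite /G /F memory_gap0 ?mulr0//.
    exact: evolution_init (ev x xac).
  - move=> [x xac]; rewrite /G /= => s; apply: continuousM; first exact: cvg_cst.
    exact: continuous_memory_gap k0 (ev x xac) s.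
  - move=> [x xac] s sT; rewrite /G /=.
    have d1 := is_derive_memory_gap k0 (ev x xac) sT.
    exact: is_derive_eq.
  - move=> s B sT GB [x xac] /=.
    have wB := est B _ _ _ _ (prof s sT) (eqw s sT)
      (fun y yac => fF s y B sT yac (GB (exist _ y yac))) x xac.
    have B0 : 0 <= B by apply: le_trans (GB (exist _ x xac)).
    have k1 : 0 <= expR (k * s) := expR_ge0 _.
    rewrite normrM (normrM k) (normrM (expR _)) (ger0_norm k0) (ger0_norm k1).
    rewrite (@gtr0_norm _ x); last lra.
    apply: (@le_trans _ _ (c * (k * (expR (k * T) * (C * B))))); last first.
      by rewrite mulrDl mul1r -!mulrA lerDr.
    apply: ler_pM; [lra | exact: mulr_ge0 k0 (mulr_ge0 k1 (normr_ge0 _)) | lra |].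
    apply: ler_wpM2l => //; apply: ler_pM => //.
    by rewrite ler_expR ler_wpM2l//; lra.
  - move=> s sT.
    have [B BP] := profile_source_bounded a0 ac b0 ga0 q0 (prof s sT) (eqw s sT).
    exists (expR (k * s) * B) => -[x xac]; rewrite /G /=.
    have -> : x * F x s = expR (k * s) * (x * f s x).
      rewrite /f mulrCA; congr (_ * _).
      by rewrite mulrA -expRD subrr expR0 mul1r.
    rewrite normrM (ger0_norm (expR_ge0 _)) ler_wpM2l ?expR_ge0//.
    by rewrite normrM (@gtr0_norm _ x) ?BP//; lra.
(* The source vanishes with G, and the spatial estimate with n = 0 gives w = 0. *)
have F0 x : a < x < c -> x * `|f t x| <= 0.
  move=> xac; apply: fF => //.
  by have := G0 (exist _ x xac) t ltac:(lra); rewrite /G /= => ->; rewrite normr0.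
have := est 0 _ _ _ _ (prof t tT) (eqw t tT) F0 r rac.
by rewrite mulr0 normr_le0 subr_eq0 => /eqP.
Qed.
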